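(* Let $(X,\omega_X)$ be a Kähler manifold of complex dimension $n$ equipped with a pseudotoric structure, i.e. with a Hamiltonian $T^k$-action on $(X,\omega_X)$ for some $1\le k\le n$, with moment map $\mu=(\mu_1,\dots,\mu_k)$, and a meromorphic map $F:X\dashrightarrow Y$ with base locus $B$ to a toric Kähler manifold $Y$ of complex dimension $n-k$ with toric Kähler form $\omega_Y$, satisfying the conditions of a pseudotoric structure. Suppose there is an anticanonical divisor $D\in|-K_X|$ and a meromorphic $n$-form $\Omega_X$ on $X$ with no zeros and only simple poles along $D$, such that: (i) $D$ is $T^k$-invariant. (ii) The holomorphic map $F:X\setminus B\to Y$ restricts to a map $F:X\setminus D\to Y\setminus E$, where $E$ is the toric anticanonical divisor in $Y$. (iii) Given a basis $\{V_1,\dots,V_k\}$ of Hamiltonian vector fields generating the $T^k$-action on $(X,\omega_X)$, we have $$\iota_{V_1}\cdots\iota_{V_k}\Omega_X=d\log F^*f_1\wedge\cdots\wedge d\log F^*f_{n-k}$$ for some $T^k$-invariant meromorphic functions $f_1,\dots,f_{n-k}$ on $Y$. (iv) The functions $\nu_j:=|f_j|$, $j=1,\dots,n-k$, on the open dense orbit $Y_0:=Y\setminus E\cong(\mathbb{C}^* )^{n-k}$ are Poisson commuting with respect to the Poisson bracket induced by $\omega_Y$. Then the map $$\rho:=(\mu_1,\dots,\mu_k,F^*\nu_1,\dots,F^*\nu_{n-k}):X\setminus D\to\mathbb{R}^n$$ defines a special Lagrangian fibration on $X\setminus D$, where the special condition is with respect to the holomorphic volume form $\Omega_X$ on $X\setminus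 D$.
   Context: Pseudotoric structure: Let $X$ be a Kähler manifold of complex dimension $n$ with Kähler form $\omega_X$. A pseudotoric structure on $X$ consists of (1) a Hamiltonian $T^k$-action on $(X,\omega_X)$, $1\le k\le n$, and (2) a meromorphic map $F:X\dashrightarrow Y$ to a toric Kähler manifold $Y$ of complex dimension $n-k$ with toric Kähler form $\omega_Y$, such that: (a) the base locus of $F$ is a $T^k$-invariant subvariety $B\subset X$ of complex dimension $k-1$; (b) the holomorphic map $F:X\setminus B\to Y$ is $T^k$-invariant; (c) for any smooth function $h$ on $Y$ one has $V_{F^*h}=f\cdot\nabla_FV_h$, where $V_{F^*h}$ and $V_h$ are the Hamiltonian vector fields of $F^*h$ on $X\setminus B$ and $h$ on $Y$ with respect to $\omega_X$ and $\omega_Y$ (convention $\iota_{V_h}\omega=dh$), $f$ is a real function on $X\setminus B$, $\nabla_F$ is the symplectic connection of the symplectic fibration $F$ (horizontal space = $\omega_X$-orthogonal complement of $\ker dF$), and $\nabla_FV_h$ is the horizontal lift of $V_h$ to $X\setminus B$. The moment map components satisfy $\iota_{V_i}\omega_X=d\mu_i$ for the basis $\{V_1,\dots,V_k\}$ coming from a basis of $\mathrm{Lie}(T^k)$. A submanifold $L\subset X\setminus D$ is special Lagrangian (with respect to $\Omega_X$) if it is Lagrangian for $\omega_X$ and $\mathrm{Im}\,(e^{\sqrt{-1}\theta}\Omega_X)|_L=0$ for some $\theta\in\mathbb{R}$. A special Lagrangian fibration is allowed to have singular fibers. *)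

(* Defs.v *)
From mathcomp Require Import all_boot all_order all_algebra complex.
From mathcomp Require Import all_classical all_reals all_analysis.
Import Order.TTheory GRing.Theory Num.Theory numFieldNormedType.Exports.

Set Implicit Arguments.
Unset Strict Implicit.
Unset Printing Implicit Defensive.

Local Open Scope classical_set_scope.
Local Open Scope ring_scope.

(* C^n as a real normed space, z = x + iy being stored as (x, y). *)
Notation Cn R n := ('rV[R]_n * 'rV[R]_n)%type.

Section Calculus.
Variable R : realType.

Definition mulI n (u : Cn R n) : Cn R n := (- u.2, u.1).
Definition mulI2 n m (u : Cn R n * Cn R m) : Cn R n * Cn R m :=
  (mulI u.1, mulI u.2).

Definition toC n (u : Cn R n) : 'rV[R[i]]_n :=
  \row_j Complex (u.1 0 j) (u.2 0 j).
Definition unit_vec n (j : 'I_n) : Cn R n := (delta_mx 0 j, 0).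

(* R[i] as the real normed plane *)
Definition cpair (z : R[i]) : R * R := let: Complex a b := z in (a, b).
Definition mulIc (z : R * R) : R * R := (- z.2, z.1).

(* f is of class C^r on the open set U *)
Fixpoint Ck (V W : normedModType R) (r : nat) (U : set V) (f : V -> W) : Prop :=
  match r with
  | 0%N => forall x, U x -> {for x, continuous f}
  | r'.+1 => (forall x, U x -> differentiable f x) /\
             forall v, Ck r' U (fun x => 'D_v f x)
  end.

Definition smooth (V W : normedModType R) (U : set V) (f : V -> W) : Prop :=
  forall r, Ck r U f.

(* Smooth and Cauchy-Riemann, for the complex structures JV and JW. *)
Definition holomorphic (V W : normedModType R) (JV : V -> V) (JW : W -> W)
    (U : set V) (f : V -> W) : Prop :=
  smooth U f /\ forall x v, U x -> 'D_(JV v) f x = JW ('D_v f x).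

End Calculus.

(* The atlas is indexed by the points: [chart p] is a chart defined on an open
   neighbourhood [dom p] of p, with inverse [chartV p].  Any complex atlas can
   be presented in this way.  The tangent space at p is then C^n, through the
   differential of [chart p]. *)
Record complexManifold (R : realType) (n : nat) := ComplexManifold {
  point :> topologicalType;
  dom : point -> set point;
  chart : point -> point -> Cn R n;
  chartV : point -> Cn R n -> point;
  cm_hausdorff : hausdorff_space point;
  cm_second_countable : @second_countable point;
  cm_connected : connected [set: point];
  dom_open : forall p, open (dom p);
  dom_self : forall p, dom p p;
  chart_open : forall p, open (chart p @` dom p);
  chartK : forall p x, dom p x -> chartV p (chart p x) = x;
  chart_continuous : forall p x, dom p x -> {for x, continuous (chart p)};
  chartV_continuous :
    forall p z, (chart p @` dom p) z -> {for z, continuous (chartV p)};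
  chart_transition : forall p q,
    holomorphic (@mulI R n) (@mulI R n) (chart p @` (dom p `&` dom q))
                (chart q \o chartV p) }.

Section Manifolds.
Variables (R : realType) (n : nat) (X : complexManifold R n).

Definition smooth_on (W : normedModType R) (U : set X) (g : X -> W) : Prop :=
  forall p, smooth (chart p @` (dom p `&` U)) (g \o chartV p).

Definition holo_on (U : set X) (s : X -> R[i]) : Prop :=
  forall p, holomorphic (@mulI R n) (@mulIc R)
    (chart p @` (dom p `&` U)) (@cpair R \o s \o chartV p).

(* dg_p(u) *)
Definition der (W : normedModType R) (g : X -> W) (p : X) (u : Cn R n) : W :=
  'D_u (g \o chartV p) (chart p p).

Definition cder (s : X -> R[i]) (p : X) (u : Cn R n) : R[i] :=
  let d := der (@cpair R \o s) p u in Complex d.1 d.2.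

(* The tangent vector at x whose coordinates in [chart p] are a. *)
Definition tvec (p x : X) (a : Cn R n) : Cn R n :=
  'D_a (chart x \o chartV p) (chart p x).

Definition form2_coord (w : X -> Cn R n -> Cn R n -> R) (p : X)
    (a b : Cn R n) (z : Cn R n) : R :=
  let x := chartV p z in w x (tvec p x a) (tvec p x b).

Record is_kahler (w : X -> Cn R n -> Cn R n -> R) : Prop := IsKahler {
  kahler_linear : forall p c u1 u2 v,
    w p (c *: u1 + u2) v = c * w p u1 v + w p u2 v;
  kahler_anti : forall p u v, w p u v = - w p v u;
  kahler_smooth : forall p a b,
    smooth (chart p @` dom p) (form2_coord w p a b);
  kahler_closed : forall p a b c z, (chart p @` dom p) z ->
    'D_a (form2_coord w p b c) z + 'D_b (form2_coord w p c a) z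
    + 'D_c (form2_coord w p a b) z = 0;
  kahler_compat : forall p u v, w p (mulI u) (mulI v) = w p u v;
  kahler_pos : forall p u, u != 0 -> 0 < w p u (mulI u) }.

(* V is the value at p of the Hamiltonian vector field of g. *)
Definition hamiltonian_vec (w : X -> Cn R n -> Cn R n -> R) (g : X -> R)
    (p : X) (V : Cn R n) : Prop :=
  forall u, w p V u = der g p u.

Definition analytic_set (A : set X) : Prop :=
  forall p : X, exists (U : set X) (N : nat) (s : 'I_N -> X -> R[i]),
    [/\ open U, U p, forall j, holo_on U (s j) &
        forall x, U x -> (A x <-> forall j, s j x = 0)].

(* Near p, A is a complex submanifold of dimension d. *)
Definition submanifold_point (A : set X) (d : nat) (p : X) : Prop :=
  (d <= n)%N /\
  exists (U : set X) (s : 'I_(n - d) -> X -> R[i]),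
    [/\ open U, U p, forall j, holo_on U (s j),
        forall x, U x -> (A x <-> forall j, s j x = 0) &
        forall c : 'I_(n - d) -> R[i], exists u, forall j, cder (s j) p u = c j].

(* The dimension of an analytic set is the largest one of a manifold point; the
   empty set is a (degenerate) subvariety of every dimension. *)
Definition subvariety_of_dim (A : set X) (d : nat) : Prop :=
  analytic_set A /\
  (A = set0 \/
   (exists2 p, A p & submanifold_point A d p) /\
   forall e p, A p -> submanifold_point A e p -> (e <= d)%N).

(* An n-form of type (n, 0) is given by a function h : X -> C; its value at p is
   h(p) dz_1 /\ ... /\ dz_n in the coordinates of [chart p]. *)
Definition nform (h : X -> R[i]) (p : X) (v : 'I_n -> Cn R n) : R[i] :=
  h p * \det (\matrix_(i, j) toC (v i) 0 j).

(* The coefficient at x of that form with respect to [chart p]. *)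
Definition nform_coef (h : X -> R[i]) (p x : X) : R[i] :=
  nform h x (fun i => tvec p x (unit_vec R i)).

(* s is a reduced local equation of the hypersurface D on U: its differential
   does not vanish identically on any relatively open part of D. *)
Definition reduced_equation (D U : set X) (s : X -> R[i]) : Prop :=
  [/\ holo_on U s, forall x, U x -> (D x <-> s x = 0) &
      forall O, open O -> O `&` (U `&` D) !=set0 ->
        exists2 x, (O `&` (U `&` D)) x & exists u, cder s x u != 0].

(* The form h is meromorphic, without zeros, holomorphic off D, and has a simple
   pole along D.  In other words div h = - D with D reduced, and in particular D
   is an anticanonical divisor.  The values of h on D are irrelevant. *)
Definition volume_form_simple_poles (D : set X) (h : X -> R[i]) : Prop :=
  forall p : X, exists (U : set X) (s g : X -> R[i]),
    [/\ open U, U p, U `<=` dom p, reduced_equation D U s & 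
     [/\ holo_on U g, forall x, U x -> g x != 0 &
         forall x, U x -> ~ D x -> s x * nform_coef h p x = g x]].

(* f is a quotient of holomorphic functions near every point; the values of f
   at its poles are irrelevant. *)
Definition meromorphic_function (f : X -> R[i]) : Prop :=
  forall p : X, exists (U : set X) (a b : X -> R[i]),
    [/\ open U, U p, holo_on U a, holo_on U b &
     (forall O, open O -> O `&` U !=set0 ->
        exists2 x, (O `&` U) x & b x != 0) /\
     forall x, U x -> b x != 0 -> f x = a x / b x].

End Manifolds.

Section Maps.
Variables (R : realType) (n m : nat).
Variables (X : complexManifold R n) (Y : complexManifold R m).

Definition holo_map (U : set X) (F : X -> Y) : Prop :=
  (forall x, U x -> {for x, continuous F}) /\
  forall (p : X) (q : Y), holomorphic (@mulI R n) (@mulI R m)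
    (chart p @` (dom p `&` U `&` F @^-1` dom q)) (chart q \o F \o chartV p).

(* dF_p(u) *)
Definition tmap (F : X -> Y) (p : X) (u : Cn R n) : Cn R m :=
  'D_u (chart (F p) \o F \o chartV p) (chart p p).

Definition holo_on_prod (U : set (X * Y)) (s : X * Y -> R[i]) : Prop :=
  forall (p : X) (q : Y), holomorphic (@mulI2 R n m) (@mulIc R)
    ((fun xy : X * Y => (chart p xy.1, chart q xy.2)) @`
       ((dom p `*` dom q) `&` U))
    (fun zw : Cn R n * Cn R m => cpair (s (chartV p zw.1, chartV q zw.2))).

Definition analytic_set_prod (A : set (X * Y)) : Prop :=
  forall pq : X * Y,
    exists (U : set (X * Y)) (N : nat) (s : 'I_N -> X * Y -> R[i]),
    [/\ open U, U pq, forall j, holo_on_prod U (s j) &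
        forall x, U x -> (A x <-> forall j, s j x = 0)].

Definition graph_closure (B : set X) (F : X -> Y) : set (X * Y) :=
  closure [set xy | ~ B xy.1 /\ xy.2 = F xy.1].

(* Meromorphic map in the sense of Remmert, with indeterminacy locus B; the
   values of F on B are irrelevant. *)
Record meromorphic_map (B : set X) (F : X -> Y) : Prop := MeromorphicMap {
  mero_analytic : analytic_set B;
  mero_dense : dense (~` B);
  mero_holo : holo_map (~` B) F;
  mero_graph : analytic_set_prod (graph_closure B F);
  mero_proper : forall K : set X, compact K ->
    compact (graph_closure B F `&` (K `*` setT));
  mero_indeterminacy : forall p, B p ->
    ~ exists (U : set X) (G : X -> Y),
        [/\ open U, U p, holo_map U G & forall x, U x -> ~ B x -> G x = F x] }.

(* W is the horizontal lift at p of the tangent vector v at F p, the horizontal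
   space being the w-orthogonal of ker dF. *)
Definition horizontal_lift (w : X -> Cn R n -> Cn R n -> R) (F : X -> Y)
    (p : X) (v : Cn R m) (W : Cn R n) : Prop :=
  (forall u, tmap F p u = 0 -> w p W u = 0) /\ tmap F p W = v.

End Maps.

Record kahlerManifold (R : realType) (n : nat) := KahlerManifold {
  km_manifold :> complexManifold R n;
  kform : km_manifold -> Cn R n -> Cn R n -> R;
  kformP : is_kahler kform }.

Section TorusActions.
Variables (R : realType) (k n : nat) (X : complexManifold R n).

(* A smooth action of T^k, seen as an action of R^k trivial on 2 pi Z^k. *)
Record torus_action (act : 'rV[R]_k -> X -> X) : Prop := TorusAction {
  torus_act0 : forall x, act 0 x = x;
  torus_actD : forall s t x, act (s + t) x = act s (act t x);
  torus_period : forall j x, act ((2 * pi) *: delta_mx 0 j) x = x;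
  torus_continuous : continuous (fun sx : 'rV[R]_k * X => act sx.1 sx.2);
  torus_smooth : forall p q : X,
    smooth [set sz | exists2 x, dom p x &
                       dom q (act sz.1 x) /\ sz.2 = chart p x]
      (fun sz : 'rV[R]_k * Cn R n => chart q (act sz.1 (chartV p sz.2))) }.

(* The vector field generated by xi in Lie(T^k) = R^k. *)
Definition fundamental_field (act : 'rV[R]_k -> X -> X) (xi : 'rV[R]_k)
    (p : X) : Cn R n :=
  'D_xi (fun s => chart p (act s p)) 0.

(* mu is a moment map, in the basis of Lie(T^k) formed by the rows of xi. *)
Record moment_map (w : X -> Cn R n -> Cn R n -> R) (act : 'rV[R]_k -> X -> X)
    (xi : 'M[R]_k) (mu : X -> 'rV[R]_k) : Prop := MomentMap {
  moment_smooth : smooth_on setT mu;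
  moment_eq : forall i p,
    hamiltonian_vec w (fun x => mu x 0 i) p (fundamental_field act (row i xi) p);
  moment_invariant : forall s x, mu (act s x) = mu x }.

Record hamiltonian_action (w : X -> Cn R n -> Cn R n -> R)
    (act : 'rV[R]_k -> X -> X) : Prop := HamiltonianAction {
  ham_action : torus_action act;
  ham_symplectic : forall s p u v,
    w (act s p) (tmap (act s) p u) (tmap (act s) p v) = w p u v;
  ham_moment : exists mu, moment_map w act 1%:M mu }.

(* The vector fields V_i generated by the rows of xi generate the action and
   form a basis, i.e. are linearly independent as vector fields on X. *)
Definition generating_basis (act : 'rV[R]_k -> X -> X) (xi : 'M[R]_k) : Prop :=
  xi \in unitmx /\
  forall c : 'I_k -> R,
    (forall x, \sum_i c i *: fundamental_field act (row i xi) x = 0) ->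
    forall i, c i = 0.

End TorusActions.

(* (C^* )^m is C^m / 2 pi i Z^m, through exp, and acts holomorphically; the
   compact torus T^m is {0} x R^m / 2 pi Z^m. *)
Record toricKahlerManifold (R : realType) (m : nat) := ToricKahlerManifold {
  tk_manifold :> kahlerManifold R m;
  tk_act : Cn R m -> tk_manifold -> tk_manifold;
  tk_base : tk_manifold;
  tk_act0 : forall y, tk_act 0 y = y;
  tk_actD : forall u v y, tk_act (u + v) y = tk_act u (tk_act v y);
  tk_period : forall j y, tk_act (0, (2 * pi) *: delta_mx 0 j) y = y;
  tk_continuous :
    continuous (fun uy : Cn R m * tk_manifold => tk_act uy.1 uy.2);
  tk_holo : forall p q : tk_manifold,
    holomorphic (@mulI2 R m m) (@mulI R m)
      [set uz | exists2 y, dom p y & dom q (tk_act uz.1 y) /\ uz.2 = chart p y]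
      (fun uz : Cn R m * Cn R m => chart q (tk_act uz.1 (chartV p uz.2)));
  tk_free : forall u, tk_act u tk_base = tk_base ->
    exists z : 'I_m -> int, u = (0, \row_j (2 * pi * (z j)%:~R));
  tk_orbit_open : open (range (tk_act^~ tk_base));
  tk_orbit_dense : dense (range (tk_act^~ tk_base));
  tk_hamiltonian :
    hamiltonian_action (@kform R m tk_manifold) (fun t => tk_act (0, t)) }.

Definition open_orbit (R : realType) m (Y : toricKahlerManifold R m) : set Y :=
  range (@tk_act R m Y ^~ (tk_base Y)).
Definition toric_divisor (R : realType) m (Y : toricKahlerManifold R m) : set Y :=
  ~` @open_orbit R m Y.

(* X has complex dimension n = k + m. *)
Record pseudotoric (R : realType) (k m : nat) (X : kahlerManifold R (k + m))
    (Y : toricKahlerManifold R m) := Pseudotoric {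
  ps_act : 'rV[R]_k -> X -> X;
  ps_map : X -> Y;
  ps_base : set X;
  ps_rank : (0 < k)%N;
  ps_hamiltonian : hamiltonian_action (@kform R (k + m) X) ps_act;
  ps_mero : meromorphic_map ps_base ps_map;
  ps_base_dim : subvariety_of_dim ps_base k.-1;
  ps_base_inv : forall s x, ps_base (ps_act s x) <-> ps_base x;
  ps_map_inv : forall s x, ~ ps_base x -> ps_map (ps_act s x) = ps_map x;
  (* V_{F^*h} = f . nabla_F V_h, at the points where F is a submersion, which
     are those where tangent vectors can be lifted *)
  ps_lift : exists f : X -> R, forall h : Y -> R, smooth_on setT h ->
    forall x, ~ ps_base x -> (forall v, exists u, tmap ps_map x u = v) ->
    forall V v W, hamiltonian_vec (@kform R (k + m) X) (h \o ps_map) x V ->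
      hamiltonian_vec (@kform R m Y) h (ps_map x) v ->
      horizontal_lift (@kform R (k + m) X) ps_map x v W ->
      V = f x *: W }.

Definition cmod (R : realType) (z : R[i]) : R := ComplexField.Normc.normc z.

Section PoissonDlog.
Variables (R : realType) (n : nat).

(* The Poisson bracket of g1 and g2 vanishes at p. *)
Definition poisson_commute_at (X : kahlerManifold R n) (g1 g2 : X -> R) (p : X)
    : Prop :=
  forall V1 V2, hamiltonian_vec (@kform R n X) g1 p V1 ->
    hamiltonian_vec (@kform R n X) g2 p V2 -> kform p V1 V2 = 0.

Definition dlog (X : complexManifold R n) (s : X -> R[i]) (p : X) (u : Cn R n)
    : R[i] := cder s p u / s p.

End PoissonDlog.

Section SpecialLagrangian.
Variables (R : realType) (n : nat) (X : kahlerManifold R n).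

(* Near the points of U, L is the regular zero set of g, hence a submanifold of
   real codimension n, i.e. of real dimension n. *)
Definition local_equation (L U : set X) (g : X -> 'rV[R]_n) : Prop :=
  [/\ open U, smooth_on U g, forall x, U x -> (L x <-> g x = 0) &
      forall x, U x -> forall w, exists u, der g x u = w].

Definition half_dim_submanifold (L : set X) : Prop :=
  forall x, L x -> exists (U : set X) (g : X -> 'rV[R]_n),
    U x /\ local_equation L U g.

(* T_x L: the common kernel of the differentials of the local equations *)
Definition tangent (L : set X) (x : X) (u : Cn R n) : Prop :=
  forall (U : set X) (g : X -> 'rV[R]_n),
    U x -> local_equation L U g -> der g x u = 0.

Definition lagrangian (L : set X) : Prop :=
  half_dim_submanifold L /\
  forall x u v, L x -> tangent L x u -> tangent L x v -> kform x u v = 0.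

Definition special_lagrangian (h : X -> R[i]) (L : set X) : Prop :=
  lagrangian L /\
  exists theta : R, forall x (v : 'I_n -> Cn R n), L x ->
    (forall i, tangent L x (v i)) ->
    complex.Im (Complex (cos theta) (sin theta) * nform h x v) = 0.

Definition regular_point (rho : X -> 'rV[R]_n) (x : X) : Prop :=
  (exists U : set X, [/\ open U, U x & smooth_on U rho]) /\
  forall w, exists u, der rho x u = w.

(* Singular fibres are allowed: rho is a submersion on a dense subset of M, and
   the regular part of every fibre is special Lagrangian. *)
Definition special_lagrangian_fibration (h : X -> R[i]) (M : set X)
    (rho : X -> 'rV[R]_n) : Prop :=
  (forall O : set X, open O -> O `&` M !=set0 ->
     exists2 x, (O `&` M) x & regular_point rho x) /\
  forall c, special_lagrangian h
    [set x | [/\ M x, regular_point rho x & rho x = c]].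

End SpecialLagrangian.

(* Main.v *)
Require Import Defs.
From HB Require Import structures.
From mathcomp Require Import all_boot all_order all_algebra complex.
From mathcomp Require Import all_classical all_reals all_analysis.
From mathcomp Require Import ring lra.
Import Order.TTheory GRing.Theory Num.Theory numFieldNormedType.Exports.

(* Off [D], write [V_a] for the given Hamiltonian fields, [alpha_j] for the forms
   [dlog (F^* f_j)] and [nu_j = |f_j|].  The contraction formula shows that, where
   the [f_j] do not vanish, the [alpha_j] are independent as soon as the [V_a] are
   (the [V_a] are isotropic, hence independent over C as soon as they are over R).
   Since [d nu_j = nu_j Re alpha_j], the components of [rho] then have independent
   differentials, and [F] is a submersion.

   Such points are dense: if the [V_a] are dependent on an open set, then by
   rationality of the isotropy algebras and Baire's theorem a circle of the torus
   has a zero field on an open set, and a rigidity argument for periodic flows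
   propagates this to the connected manifold [X], which contradicts the choice of
   the [V_a].

   At a regular point the tangent space of the fibre is spanned by the [V_a] and by
   the Hamiltonian vectors [H_j] of [nu_j o F].  It is isotropic because [mu] and [F]
   are invariant, and because the lifting condition makes the horizontal part of
   [omega_X] proportional to [F^* omega_Y], so that the [H_j] inherit the Poisson
   commutation of the [nu_j].  Isotropy also gives [Re alpha_j (H_i) = 0], so
   [Omega (V, H) = det (alpha_j (H_i))] is a real multiple of [i^m]: the phase is
   constant. *)

Set Implicit Arguments.
Unset Strict Implicit.
Unset Printing Implicit Defensive.

Local Open Scope classical_set_scope.
Local Open Scope ring_scope.

(** * Calculus *)

(** The torus acts by symplectic diffeomorphisms that are not assumed holomorphic, so no identity
    theorem carries the vanishing of a field from an open set to the whole of [X], and a general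
    smooth field may well vanish on an open set only. What is available is periodicity. This is why
    a relation between the [V_a], whose real coefficients vary with the point, is first replaced by
    an integer one: integer vectors generate periodic flows, and there are only countably many of
    them, as Baire's theorem requires. The rigidity of such a flow comes from Rolle's theorem: a
    closed orbit cannot have a velocity that stays close to a fixed nonzero vector. The [f_j] may
    vanish inside the open orbit, where [nu_j] need not be differentiable. Such points are never
    regular: a zero is a minimum of [nu_j], so if [nu_j] is differentiable there its differential
    vanishes. *)

Section Calculus.
Context {R : realType}.
Implicit Types V W Z : normedModType R.

(** Finite dimension is expressed by continuous coordinates, a form that passes to products such as
    [Cn R n] and allows differentiation coordinate by coordinate. *)
Definition findim W := exists (N : nat) (e : 'I_N -> W) (l : 'I_N -> W -> R),
  [/\ forall i, continuous (l i), forall i, linear (l i : W -> R^o) &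
      forall w, w = \sum_i l i w *: e i].

Lemma linP V W (f : V -> W) : linear f -> {F : {linear V -> W} | F = f :> (V -> W)}.
Proof.
move=> lf.
pose F : {linear V -> W} := HB.pack f (GRing.isLinear.Build R V W *:%R f lf).
by exists F.
Qed.

Lemma sum_continuous V W N (g : 'I_N -> V -> W) (x : V) :
  (forall i, {for x, continuous (g i)}) ->
  {for x, continuous (fun y => \sum_i g i y)}.
Proof.
move=> h; have -> : (fun y => \sum_i g i y) = \sum_i g i by rewrite fct_sumE.
elim/big_ind : _ => [|a b ha hb|i _]; [exact: cst_continuous|exact: continuousD|exact: h].
Qed.

Lemma findim_linear_continuous V W (f : V -> W) :
  findim V -> linear f -> continuous f.
Proof.
move=> [N [e [l [lc ll eq]]]] /linP[F <-] x.
have -> : (F : V -> W) = (fun y => \sum_i l i y *: F (e i)).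
  by apply/funext => y; rewrite {1}(eq y) linear_sum; apply: eq_bigr => i _; rewrite linearZ.
apply: sum_continuous => i; apply: cvgZr_tmp; exact: lc.
Qed.

Lemma differentiable_linear V W (f : V -> W) x :
  continuous f -> linear f -> differentiable f x.
Proof. by move=> cf /linP[F eF]; rewrite -eF; apply: linear_differentiable; rewrite eF. Qed.

Lemma derive_linear V W (f : V -> W) x v :
  continuous f -> linear f -> 'D_v f x = f v.
Proof.
move=> cf lf; rewrite deriveE; last exact: differentiable_linear.
by move: lf cf => /linP[F <-] cf; rewrite diff_lin.
Qed.

Lemma derive_comp V W Z (f : V -> W) (g : W -> Z) x v :
  differentiable f x -> differentiable g (f x) ->
  'D_v (g \o f) x = 'D_('D_v f x) g (f x).
Proof.
move=> df dg; rewrite !deriveE //; last exact: differentiable_comp.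
by rewrite diff_comp.
Qed.

Lemma deriveDl V W (f : V -> W) x u v :
  differentiable f x -> 'D_(u + v) f x = 'D_u f x + 'D_v f x.
Proof. by move=> df; rewrite !deriveE // linearD. Qed.

Lemma deriveZl V W (f : V -> W) x c v :
  differentiable f x -> 'D_(c *: v) f x = c *: 'D_v f x.
Proof. by move=> df; rewrite !deriveE // linearZ. Qed.

Lemma derive_is_linear V W (f : V -> W) x :
  differentiable f x -> linear (fun v => 'D_v f x).
Proof. by move=> df c u v; rewrite deriveDl // deriveZl. Qed.

Lemma derive_sum_dir V W (f : V -> W) x N (c : 'I_N -> R) (v : 'I_N -> V) :
  differentiable f x ->
  'D_(\sum_i c i *: v i) f x = \sum_i c i *: 'D_(v i) f x.
Proof.
move=> df; rewrite deriveE // linear_sum; apply: eq_bigr => i _.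
by rewrite linearZ deriveE.
Qed.

Lemma near_differentiable V W (f g : V -> W) x :
  (\forall y \near x, f y = g y) -> differentiable f x -> differentiable g x.
Proof.
move=> fg df; have e := nbhs_singleton fg.
have [dc /eqaddoP dx] := (diff_locallyP x f).1 df.
have dg : g \o shift x = cst (g x) + 'd f x +o_ 0 id.
  apply/eqaddoP => eps eps0; have := dx _ eps0.
  have : \forall h \near (0 : V), f (h + x) = g (h + x).
    have cs : {for 0, continuous (fun h : V => h + x)}.
      by move=> ?; apply: cvgD => //; exact: cvg_cst.
    by apply: (cs (fun y => f y = g y)); rewrite /= add0r.
  apply: filterS2 => z.
  by rewrite !fctE /= => -> //; rewrite e.
apply/diff_locallyP; rewrite (diff_unique dc dg); split => //.
Qed.

Lemma findimR : findim (R : normedModType R).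
Proof.
exists 1%N, (fun=> 1), (fun=> id); split=> // [i x|w]; first exact: cvg_id.
by rewrite big_ord1 [RHS]mulr1.
Qed.

Lemma findim_rV n : findim ('rV[R]_n : normedModType R).
Proof.
exists n, (fun j => delta_mx 0 j), (fun j (u : 'rV[R]_n) => u 0 j); split => [i|i c u v|w].
- exact: coord_continuous.
- by rewrite !mxE.
- exact: row_sum_delta.
Qed.

Lemma findim_prod V W : findim V -> findim W -> findim (V * W)%type.
Proof.
move=> [N1 [e1 [l1 [c1 L1 q1]]]] [N2 [e2 [l2 [c2 L2 q2]]]].
exists (N1 + N2)%N, (fun i => match fintype.split i with inl a => (e1 a, 0) | inr b => (0, e2 b) end),
  (fun i (w : V * W) => match fintype.split i with inl a => l1 a w.1 | inr b => l2 b w.2 end).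
split => [i|i c u v|[v w]].
- case: (fintype.split i) => a x.
  + by apply: continuous_comp; [exact: cvg_fst|exact: c1].
  + by apply: continuous_comp; [exact: cvg_snd|exact: c2].
- by case: (fintype.split i) => a /=; [rewrite L1|rewrite L2].
- rewrite big_split_ord /=.
  under eq_bigr do rewrite (unsplitK (inl _)).
  under [in X in _ + X]eq_bigr do rewrite (unsplitK (inr _)).
  rewrite (_ : (v, w) = (v, 0) + (0, w)); last by congr pair; rewrite ?addr0 ?add0r.
  congr (_ + _); [rewrite [in LHS](q1 v)|rewrite [in LHS](q2 w)];
  elim/big_rec2 : _ => // i a b _ <-; congr pair => /=; by rewrite ?scaler0 ?addr0.
Qed.

Lemma findim_Cn n : findim (Cn R n : normedModType R).
Proof. by apply: findim_prod; exact: findim_rV. Qed.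

(** * Closure properties of the classes C^r *)

Section CkTheory.
Context {V : normedModType R}.
Implicit Types (U : set V).

Lemma Ck_mono W r U U' (f : V -> W) : U' `<=` U -> Ck r U f -> Ck r U' f.
Proof.
move=> s; elim: r f => [|r IH] f /=; first by move=> h x /s; exact: h.
by move=> [h1 h2]; split => [x /s|v]; [exact: h1|exact: IH].
Qed.

Lemma Ck_pred W r U (f : V -> W) : Ck r.+1 U f -> Ck r U f.
Proof.
elim: r f => [|r IH] f [h1 h2].
  by move=> x /h1; exact: differentiable_continuous.
by split => // v; exact: IH.
Qed.

Lemma Ck_local W r U (f : V -> W) :
  (forall x, U x -> exists2 O : set V, O x & Ck r O f) -> Ck r U f.
Proof.
elim: r f => [|r IH] f h /=; first by move=> x /h [A Ax]; apply.
split => [x /h [A Ax [+ _]]|v]; first by apply.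
by apply: IH => x /h [A Ax [_ hA]]; exists A => //; exact: hA.
Qed.

Lemma Ck_congr W r U (f g : V -> W) : open U -> (forall x, U x -> f x = g x) ->
  Ck r U f -> Ck r U g.
Proof.
move=> oU; have nU x : U x -> nbhs x U by move=> Ux; apply: open_nbhs_nbhs.
elim: r f g => [|r IH] f g fg /=.
  move=> cf x Ux; have h : continuous_at x f := cf x Ux.
  suff : continuous_at x g by [].
  move: h; rewrite /continuous_at (fg x Ux); apply: cvg_trans; apply: near_eq_cvg.
  by apply: filterS (nU x Ux) => y /fg.
move=> [df h]; split => [x Ux|v].
  apply: near_differentiable (df x Ux).
  by apply: filterS (nU x Ux) => y /fg.
apply: IH (h v) => x Ux; apply: near_eq_derive.
by apply: filterS (nU x Ux) => y /fg.
Qed.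

Lemma Ck_cst W r U (a : W) : Ck r U (fun=> a).
Proof.
elim: r a => [|r IH] a /=; first by move=> x _; exact: cst_continuous.
split => [x _|v]; first exact: differentiable_cst.
rewrite (_ : 'D_v _ = fun=> 0); first exact: IH.
by apply/funext => x; exact: derive_cst.
Qed.

Lemma Ck_add W r U (f g : V -> W) : open U ->
  Ck r U f -> Ck r U g -> Ck r U (fun x => f x + g x).
Proof.
move=> oU; elim: r f g => [|r IH] f g /=.
  by move=> cf cg x Ux; apply: continuousD; [exact: cf|exact: cg].
move=> [df hf] [dg hg]; split => [x Ux|v].
  by apply: differentiableD; [exact: df|exact: dg].
apply: (Ck_congr oU _ (IH _ _ (hf v) (hg v))) => x Ux.
by rewrite deriveD //; apply: diff_derivable; [exact: df|exact: dg].
Qed.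

Lemma Ck_sum W r U N (f : 'I_N -> V -> W) : open U ->
  (forall i, Ck r U (f i)) -> Ck r U (fun x => \sum_i f i x).
Proof.
move=> oU h; rewrite -fct_sumE; elim/big_ind : _ => //=; first exact: Ck_cst.
by move=> a b; exact: Ck_add.
Qed.

Lemma Ck_mul r U (f g : V -> R) : open U ->
  Ck r U f -> Ck r U g -> Ck r U (fun x => f x * g x).
Proof.
move=> oU; elim: r f g => [|r IH] f g.
  by move=> cf cg x Ux; apply: continuousM; [exact: cf|exact: cg].
move=> Cf Cg; have Cf' := Ck_pred Cf; have Cg' := Ck_pred Cg.
case: Cf => df hf; case: Cg => dg hg; split => [x Ux|v].
  by apply: differentiableM; [exact: df|exact: dg].
have := Ck_add oU (IH _ _ Cf' (hg v)) (IH _ _ Cg' (hf v)).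
apply: Ck_congr => // x Ux.
by rewrite deriveM //; apply: diff_derivable; [exact: df|exact: dg].
Qed.

Lemma Ck_linear W Z r U (f : V -> W) (l : W -> Z) : open U ->
  continuous l -> linear l -> Ck r U f -> Ck r U (l \o f).
Proof.
move=> oU cl ll; elim: r f => [|r IH] f /=.
  by move=> cf x Ux; apply: continuous_comp; [exact: cf|exact: cl].
move=> [df hf]; split => [x Ux|v].
  by apply: differentiable_comp; [exact: df|exact: differentiable_linear].
apply: (Ck_congr oU _ (IH _ (hf v))) => x Ux /=.
by rewrite (derive_comp v (df x Ux) (differentiable_linear (f x) cl ll)) (derive_linear _ _ cl ll).
Qed.

End CkTheory.

(** [Ck] only controls derivatives along fixed directions, whereas the chain rule differentiates [g]
    along the moving direction ['D_v f x]. Coordinates of [W] expand it over the fixed vectors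
    [e i]; this is where [findim] enters. *)
Lemma Ck_comp_scalar V W r (U : set V) (T : set W) (f : V -> W) (g : W -> R) :
  findim W -> open U -> (forall x, U x -> T (f x)) ->
  Ck r U f -> Ck r T g -> Ck r U (g \o f).
Proof.
move=> [N [e [l [lc ll eq]]]] oU UT; elim: r g => [|r IH] g.
  by move=> cf cg x Ux; apply: continuous_comp; [exact: cf|apply: cg; exact: UT].
move=> Cf Cg; have Cf' := Ck_pred Cf.
case: Cf => df hf; case: Cg => dg hg; split => [x Ux|v].
  by apply: differentiable_comp; [exact: df|apply: dg; exact: UT].
have h i : Ck r U (fun x => l i ('D_v f x) * 'D_(e i) g (f x)).
  apply: Ck_mul => //; first exact: (Ck_linear oU (lc i) (ll i) (hf v)).
  exact: (IH _ Cf' (hg (e i))).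
apply: (Ck_congr oU _ (Ck_sum oU h)) => x Ux.
have dgx := dg _ (UT _ Ux).
by rewrite (derive_comp v (df x Ux) dgx) [in RHS](eq ('D_v f x)) derive_sum_dir.
Qed.

Lemma Ck_coords V W r (U : set V) (f : V -> W) N (e : 'I_N -> W) (l : 'I_N -> W -> R) :
  (forall w, w = \sum_i l i w *: e i) -> open U ->
  (forall i, Ck r U (fun x => l i (f x))) -> Ck r U f.
Proof.
move=> eq oU h.
have h' i : Ck r U (fun x => l i (f x) *: e i).
  apply: (@Ck_linear _ _ _ _ _ (fun x => l i (f x)) (fun c : R => c *: e i)) => //.
    exact: scalel_continuous.
  by move=> c u v; rewrite scalerDl scalerA.
by apply: (Ck_congr oU _ (Ck_sum oU h')) => x Ux; rewrite [RHS]eq.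
Qed.

Lemma Ck_comp V W Z r (U : set V) (T : set W) (f : V -> W) (g : W -> Z) :
  findim W -> findim Z -> open U -> open T -> (forall x, U x -> T (f x)) ->
  Ck r U f -> Ck r T g -> Ck r U (g \o f).
Proof.
move=> fW [N [e [l [lc ll eq]]]] oU oT UT Cf Cg.
apply: (Ck_coords eq oU) => i.
apply: (Ck_comp_scalar fW oU UT Cf (g := l i \o g)).
exact: Ck_linear.
Qed.

Lemma Ck_inv r : Ck r [set x : R | x != 0] (fun x => x^-1).
Proof.
have oU : open [set x : R | x != 0] by exact: open_neq.
elim: r => [|r IH] /=; first by move=> x x0; exact: inv_continuous.
split=> [x x0|v]; first exact: differentiable_Rinv.
have := Ck_mul oU (Ck_cst r _ (- v)) (Ck_mul oU IH IH).
apply: Ck_congr => // x x0; rewrite deriveE; last exact: differentiable_Rinv.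
by rewrite diff_Rinv // [RHS]mulNr mulNr -invfM mulrC.
Qed.

Lemma Ck_sqrt r : Ck r [set x : R | 0 < x] (fun x => Num.sqrt x).
Proof.
have oU : open [set x : R | 0 < x] by exact: open_gt.
elim: r => [|r IH] /=; first by move=> x x0; exact: sqrt_continuous.
have d (x : R) : 0 < x -> is_derive x 1 (fun x : R => Num.sqrt x) (2 * Num.sqrt x)^-1 by exact: is_derive1_sqrt.
split=> [x /d [? _]|v]; first exact/derivable1_diffP.
have C2 : Ck r [set x : R | 0 < x] (fun x => (Num.sqrt x)^-1).
  apply: (@Ck_comp_scalar _ _ _ _ _ (fun x => Num.sqrt x) (fun x => x^-1) findimR oU _ IH (Ck_inv r)) => x /=.
  by rewrite -sqrtr_gt0 => /lt0r_neq0.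
have := Ck_mul oU (Ck_cst r _ (v / 2)) C2.
apply: Ck_congr => // x /= /d [/derivable1_diffP dx D1].
by rewrite -{2}[v]mulr1 deriveZl // D1 invfM -mulrA.
Qed.

End Calculus.

(** * Charts *)

Section Manifold.
Context {R : realType} {n : nat} {X : complexManifold R n}.
Implicit Types (p q x : X) (U : set X).

Lemma chartVK p z : (chart p @` dom p) z -> chart p (chartV p z) = z.
Proof. by move=> [x dx <-]; rewrite chartK. Qed.

Lemma dom_chartV p z : (chart p @` dom p) z -> dom p (chartV p z).
Proof. by move=> [x dx <-]; rewrite chartK. Qed.

Lemma chartV_self p : chartV p (chart p p) = p.
Proof. by rewrite chartK //; exact: dom_self. Qed.

Lemma near_dom p x : dom p x -> \forall y \near x, dom p y.
Proof. by move=> dx; apply: open_nbhs_nbhs; split => //; exact: dom_open. Qed.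

Lemma chartV_cts p x : dom p x -> {for chart p x, continuous (chartV p)}.
Proof. by move=> dx; apply: chartV_continuous; exists x. Qed.

Lemma near_chartV p x (P : set X) : dom p x -> nbhs x P ->
  \forall z \near chart p x, P (chartV p z).
Proof. by move=> dx Px; apply: (chartV_cts dx); rewrite chartK. Qed.

Lemma near_chart p x (P : set (Cn R n)) : dom p x -> nbhs (chart p x) P ->
  \forall y \near x, P (chart p y).
Proof. by move=> dx Px; apply: (chart_continuous dx). Qed.

Lemma near_chartVK p x : dom p x ->
  \forall z \near chart p x, (chart p @` dom p) z.
Proof. by move=> dx; apply: open_nbhs_nbhs; split; [exact: chart_open|exists x]. Qed.

Lemma open_img p U : open U -> open (chart p @` (dom p `&` U)).
Proof.
move=> oU; rewrite openE => _ [x [dx Ux] <-].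
have h := near_chartV dx (open_nbhs_nbhs (conj oU Ux)).
move: h (near_chartVK dx); apply: filterS2 => z Uz dz.
by exists (chartV p z); [split => //; exact: dom_chartV|exact: chartVK].
Qed.

Lemma transition_smooth p q r :
  Ck r (chart p @` (dom p `&` dom q)) (chart q \o chartV p).
Proof. by have [+ _] := chart_transition p q; exact. Qed.

Lemma transition_diff p q x : dom p x -> dom q x ->
  differentiable (chart q \o chartV p) (chart p x).
Proof. by move=> dp dq; have [+ _] := transition_smooth p q 1; apply; exists x. Qed.

Definition mdiff (W : normedModType R) (g : X -> W) x : Prop :=
  differentiable (g \o chartV x) (chart x x).

Section Curve.
Context {E W : normedModType R} (c : E -> X) (e : E) (x : X) (g : X -> W).
Hypotheses (ce : c e = x) (cc : {for e, continuous c}).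
Hypotheses (dc : differentiable (chart x \o c) e) (dg : mdiff g x).

Lemma near_curve (P : set X) : nbhs x P -> \forall s \near e, P (c s).
Proof. by move=> Px; apply: cc; rewrite ce. Qed.

Let germ : \forall s \near e, ((g \o chartV x) \o (chart x \o c)) s = (g \o c) s.
Proof.
by apply: filterS (near_curve (near_dom (dom_self x))) => s d /=; rewrite chartK.
Qed.

Lemma curve_diff : differentiable (g \o c) e.
Proof.
apply: near_differentiable germ _.
by apply: differentiable_comp; [exact: dc|rewrite [X in differentiable _ X]/= ce; exact: dg].
Qed.

(** The parameter space [E] is arbitrary, so that one chain rule serves changes of charts
    ([der_chart]), maps between manifolds ([der_comp]) and orbits ([der_velocity]). *)
Lemma curve_der v : 'D_v (g \o c) e = der g x ('D_v (chart x \o c) e).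
Proof.
have dgx : differentiable (g \o chartV x) ((chart x \o c) e).
  by rewrite [X in differentiable _ X]/= ce; exact: dg.
have := derive_comp v dc dgx; rewrite (near_eq_derive _ germ) => ->.
by rewrite [X in derive _ X]/= ce.
Qed.

End Curve.

Lemma smooth_diff (W : normedModType R) U (g : X -> W) p x : smooth_on U g ->
  U x -> dom p x -> differentiable (g \o chartV p) (chart p x).
Proof. by move=> sg Ux dx; have [+ _] := sg p 1%N; apply; exists x. Qed.

Lemma smooth_mdiff (W : normedModType R) U (g : X -> W) x : smooth_on U g ->
  U x -> mdiff g x.
Proof. by move=> sg Ux; apply: smooth_diff sg Ux (dom_self x). Qed.

Lemma der_chart (W : normedModType R) p x (g : X -> W) a : dom p x -> mdiff g x ->
  'D_a (g \o chartV p) (chart p x) = der g x (tvec p x a).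
Proof.
move=> dx dg; apply: (curve_der (chartK dx) (chartV_cts dx) _ dg).
exact: transition_diff (dom_self x).
Qed.

Lemma mdiff_chart (W : normedModType R) p x (g : X -> W) : dom p x -> mdiff g x ->
  differentiable (g \o chartV p) (chart p x).
Proof.
move=> dx dg; apply: (curve_diff (chartK dx) (chartV_cts dx) _ dg).
exact: transition_diff (dom_self x).
Qed.

Lemma mdiff_chart_fun p x : dom p x -> mdiff (chart p) x.
Proof. by move=> dx; apply: transition_diff => //; exact: dom_self. Qed.

Lemma tvec_linear p x : dom p x -> linear (tvec p x).
Proof. by move=> dx; apply: derive_is_linear; apply: transition_diff => //; exact: dom_self. Qed.

Lemma der_linear (W : normedModType R) (g : X -> W) x : mdiff g x -> linear (der g x).
Proof. exact: derive_is_linear. Qed.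

Lemma Ktvec p x u : dom p x -> tvec p x (der (chart p) x u) = u.
Proof.
move=> dx; have dx' := dom_self x.
have germ : \forall z \near chart x x,
    ((chart x \o chartV p) \o (chart p \o chartV x)) z = id z.
  move: (near_chartV dx' (near_dom dx)) (near_chartVK dx').
  by apply: filterS2 => z d dz /=; rewrite chartK // chartVK.
have e1 : (chart p \o chartV x) (chart x x) = chart p x by rewrite /= chartV_self.
have d1 : differentiable (chart p \o chartV x) (chart x x) by exact: transition_diff.
have d2 : differentiable (chart x \o chartV p) ((chart p \o chartV x) (chart x x)).
  by rewrite e1; exact: transition_diff.
have := derive_comp u d1 d2; rewrite (near_eq_derive u germ) derive_id e1.
exact: esym.
Qed.

End Manifold.

Section Maps.
Context {R : realType} {n m : nat} {X : complexManifold R n} {Y : complexManifold R m}.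
Implicit Types (F : X -> Y) (x : X).

Definition mdiff_map F x : Prop :=
  {for x, continuous F} /\ mdiff (chart (F x) \o F) x.

Section Comp.
Context {W : normedModType R} (F : X -> Y) (x : X) (h : Y -> W).
Hypotheses (dF : mdiff_map F x) (dh : mdiff h (F x)).

Let cF : {for chart x x, continuous (F \o chartV x)}.
Proof.
apply: continuous_comp; first exact: chartV_cts (dom_self x).
by rewrite chartV_self; case: dF.
Qed.

Let eF : (F \o chartV x) (chart x x) = F x.
Proof. by rewrite /= chartV_self. Qed.

Lemma der_comp u : der (h \o F) x u = der h (F x) (tmap F x u).
Proof. exact: (curve_der eF cF dF.2 dh). Qed.

End Comp.

Lemma tmap_linear F x : mdiff_map F x -> linear (tmap F x).
Proof. by move=> [_ dF]; exact: der_linear. Qed.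

Lemma holo_map_mdiff U F x : holo_map U F -> U x -> mdiff_map F x.
Proof.
move=> [cF hF] Ux; split; first exact: cF.
have [sF _] := hF x (F x); have [+ _] := sF 1%N; apply.
by exists x => //; split; [split => //|]; exact: dom_self.
Qed.

Lemma holo_map_tmapI U F x u : holo_map U F -> U x ->
  tmap F x (mulI u) = mulI (tmap F x u).
Proof.
move=> [cF hF] Ux; have [_ +] := hF x (F x); apply.
by exists x => //; split; [split => //|]; exact: dom_self.
Qed.

End Maps.

(** * Smooth group actions *)

(** Periodicity is left out so that the same theory covers the compact torus, with [E] its Lie
    algebra, and the complex torus acting on [Y], with [E] equal to [Cn R m]. *)
Record smooth_action (R : realType) (n : nat) (E : normedModType R)
    (X : complexManifold R n) (act : E -> X -> X) : Prop := SmoothAction {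
  sa_0 : forall x, act 0 x = x;
  sa_D : forall s t x, act (s + t) x = act s (act t x);
  sa_continuous : continuous (fun sx : E * X => act sx.1 sx.2);
  sa_smooth : forall p q : X,
    smooth [set sz | exists2 x, dom p x &
                       dom q (act sz.1 x) /\ sz.2 = chart p x]
      (fun sz : E * Cn R n => chart q (act sz.1 (chartV p sz.2))) }.

Lemma continuous_pair (T U V : topologicalType) (f : T -> U) (g : T -> V) (x : T) :
  {for x, continuous f} -> {for x, continuous g} ->
  {for x, continuous (fun t => (f t, g t))}.
Proof. by move=> cf cg; apply: cvg_pair. Qed.

Section Scale.
Context {R : realType} {V : normedModType R}.

Lemma scalel_linear (v : V) : linear (fun s : R => s *: v).
Proof. by move=> a s t; rewrite scalerDl scalerA. Qed.

Lemma scalel_differentiable (v : V) (s : R) : differentiable (fun s : R => s *: v) s.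
Proof. exact: differentiable_linear (@scalel_continuous _ _ v) (scalel_linear v). Qed.

Lemma scalel_derive (v : V) (s : R) : 'D_1 (fun s : R => s *: v) s = v.
Proof. by rewrite (derive_linear _ _ (@scalel_continuous _ _ v) (scalel_linear v)) scale1r. Qed.

End Scale.

Section Actions.
Context {R : realType} {n : nat} {E : normedModType R} {X : complexManifold R n}.
Context {act : E -> X -> X} (sa : smooth_action act).

(** For [E] the Lie algebra of a torus this is [fundamental_field] by conversion. *)
Definition velocity (xi : E) (x : X) : Cn R n := 'D_xi (fun s => chart x (act s x)) 0.

Let G (p q : X) (sz : E * Cn R n) : Cn R n := chart q (act sz.1 (chartV p sz.2)).

Lemma act_continuous (s : E) (x : X) : {for (s, x), continuous (fun sx : E * X => act sx.1 sx.2)}.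
Proof. exact: (sa_continuous sa). Qed.

Lemma act_continuousl (x : X) : continuous (fun s => act s x).
Proof.
move=> s; apply: (@continuous_comp _ _ _ (fun s => (s, x)) (fun sx : E * X => act sx.1 sx.2)).
  by apply: cvg_pair => /=; [exact: cvg_id|exact: cvg_cst].
exact: act_continuous.
Qed.

Lemma act_continuousr (s : E) : continuous (act s).
Proof.
move=> x; apply: (@continuous_comp _ _ _ (fun x => (s, x)) (fun sx : E * X => act sx.1 sx.2)).
  by apply: cvg_pair => /=; [exact: cvg_cst|exact: cvg_id].
exact: act_continuous.
Qed.

Lemma G_diff p q s x : dom p x -> dom q (act s x) -> differentiable (G p q) (s, chart p x).
Proof. by move=> dx dq; have [+ _] := sa_smooth sa p q 1%N; apply; exists x. Qed.

Lemma G_dcts p q s x v : dom p x -> dom q (act s x) ->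
  {for (s, chart p x), continuous ('D_v (G p q))}.
Proof. by move=> dx dq; have [_ +] := sa_smooth sa p q 1%N; apply; exists x. Qed.

Lemma differentiable_pairl (s : E) (z : Cn R n) : differentiable (fun s : E => (s, z)) s.
Proof. by apply: differentiable_pair. Qed.

Lemma derive_pairl (s xi : E) (z : Cn R n) : 'D_xi (fun s : E => (s, z)) s = (xi, 0).
Proof.
rewrite deriveE; last exact: differentiable_pairl.
by rewrite diff_pair // diff_val /= diff_cst.
Qed.

Lemma differentiable_pairr (s : E) (z : Cn R n) : differentiable (fun z : Cn R n => (s, z)) z.
Proof. by apply: differentiable_pair. Qed.

Lemma derive_pairr (s : E) (z v : Cn R n) : 'D_v (fun z : Cn R n => (s, z)) z = (0, v).
Proof.
rewrite deriveE; last exact: differentiable_pairr.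
by rewrite diff_pair // diff_cst /= diff_val.
Qed.

Lemma orbit_diff p q s x : dom p x -> dom q (act s x) ->
  differentiable (fun s => chart q (act s x)) s.
Proof.
move=> dx dq; have := differentiable_comp (differentiable_pairl s (chart p x)) (G_diff dx dq).
by congr (differentiable _ _); apply/funext => t /=; rewrite /G /= chartK.
Qed.

Lemma orbit_derive p q s x xi : dom p x -> dom q (act s x) ->
  'D_xi (fun s => chart q (act s x)) s = 'D_(xi, 0) (G p q) (s, chart p x).
Proof.
move=> dx dq; have := derive_comp xi (differentiable_pairl s (chart p x)) (G_diff dx dq).
rewrite derive_pairl => <-.
suff -> : (fun s => chart q (act s x)) = G p q \o (fun s => (s, chart p x)) by [].
by apply/funext => t /=; rewrite /G /= chartK.
Qed.

Lemma act_chart_diff p q s x : dom p x -> dom q (act s x) ->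
  differentiable ((chart q \o act s) \o chartV p) (chart p x).
Proof.
move=> dx dq.
exact: (differentiable_comp (differentiable_pairr s (chart p x)) (G_diff dx dq)).
Qed.

Lemma act_chart_derive p q s x v : dom p x -> dom q (act s x) ->
  'D_v ((chart q \o act s) \o chartV p) (chart p x) = 'D_(0, v) (G p q) (s, chart p x).
Proof.
move=> dx dq; have := derive_comp v (differentiable_pairr s (chart p x)) (G_diff dx dq).
by rewrite derive_pairr => <-.
Qed.

Lemma act_mdiff q s x : dom q (act s x) -> mdiff (chart q \o act s) x.
Proof. by move=> dq; apply: act_chart_diff => //; exact: dom_self. Qed.

Lemma velocity_linear x : linear (velocity^~ x).
Proof.
apply: derive_is_linear; apply: (@orbit_diff x); first exact: dom_self.
by rewrite (sa_0 sa); exact: dom_self.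
Qed.

Lemma der_velocity (W : normedModType R) (g : X -> W) x xi : mdiff g x ->
  'D_xi (fun s => g (act s x)) 0 = der g x (velocity xi x).
Proof.
move=> dg; apply: (curve_der (sa_0 sa x) (@act_continuousl x 0) _ dg).
by apply: (@orbit_diff x); rewrite ?(sa_0 sa); exact: dom_self.
Qed.

Lemma derive_translate (s t xi : E) : 'D_xi (fun t : E => s + t) t = xi.
Proof.
have := @deriveD _ _ _ (cst s) id t xi (@derivable_cst _ _ _ s t xi) (@derivable_id _ _ t xi).
by rewrite derive_cst derive_id add0r.
Qed.

(** By the group law, the orbit near time [s] is the image under [act s] of the orbit near time
    0. *)
Lemma orbit_velocity q s x xi : dom q (act s x) ->
  'D_xi (fun s => chart q (act s x)) s = der (chart q \o act s) x (velocity xi x).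
Proof.
move=> dq; rewrite -der_velocity; last exact: act_mdiff.
have d1 : differentiable (fun t : E => s + t) 0 by apply: differentiableD.
have d2 : differentiable (fun s => chart q (act s x)) ((fun t : E => s + t) 0).
  by rewrite addr0; apply: orbit_diff dq; exact: dom_self.
have := derive_comp xi d1 d2.
rewrite (_ : (_ \o _) = fun t => (chart q \o act s) (act t x)); last first.
  by apply/funext => t /=; rewrite (sa_D sa).
by rewrite derive_translate addr0 => ->.
Qed.

Lemma flow_continuous x xi : continuous (fun t : R => act (t *: xi) x).
Proof.
move=> t; apply: (@continuous_comp _ _ _ (fun t : R => t *: xi) (fun s => act s x)).
  exact: scalel_continuous.
exact: act_continuousl.
Qed.

Lemma flow_diff q x xi (t : R) : dom q (act (t *: xi) x) ->
  differentiable (chart q \o (fun t : R => act (t *: xi) x)) t.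
Proof.
move=> dq.
exact: (differentiable_comp (scalel_differentiable xi t) (orbit_diff (dom_self x) dq)).
Qed.

Lemma flow_derive q x xi (t : R) : dom q (act (t *: xi) x) ->
  'D_1 (chart q \o (fun t : R => act (t *: xi) x)) t
  = der (chart q \o act (t *: xi)) x (velocity xi x).
Proof.
move=> dq; rewrite -(orbit_velocity xi dq).
have := derive_comp (1 : R) (scalel_differentiable xi t) (orbit_diff (dom_self x) dq).
by rewrite scalel_derive.
Qed.

(** The group law replaces uniqueness for differential equations: by [flow_derive] the velocity at
    time [t] is the image of the initial one under a linear map, so it vanishes, and the mean value
    theorem keeps each coordinate constant as long as the orbit stays in one chart. *)
Lemma velocity0_small x xi : velocity xi x = 0 ->
  exists2 d : R, 0 < d & forall t : R, 0 <= t < d -> act (t *: xi) x = x.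
Proof.
move=> v0; have dx := dom_self x.
pose c (t : R) := act (t *: xi) x.
have cc : continuous c by exact: flow_continuous.
have : \forall t \near (0 : R), dom x (c t).
  apply: (cc 0); rewrite /c scale0r (sa_0 sa); exact: near_dom.
move=> /nbhs_ballP[d /= d0 hd]; exists d => // t /andP[t0 td].
have dom_c s : s \in `[0, t] -> dom x (c s).
  rewrite in_itv /= => /andP[s0 st]; apply: hd.
  by rewrite /ball /= sub0r normrN ger0_norm // (le_lt_trans st).
have [N [e [l [lc ll eq]]]] := @findim_Cn R n.
have D1 s : s \in `[0, t] -> 'D_1 (chart x \o c) s = 0.
  move=> st; rewrite (flow_derive (dom_c _ st)) v0.
  have /linP[F <-] := der_linear (act_mdiff (dom_c _ st)); exact: linear0.
have dc s : s \in `[0, t] -> differentiable (chart x \o c) s.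
  by move=> /dom_c st; exact: flow_diff.
suff ex : chart x (c t) = chart x x.
  have tt : t \in `[0, t] by rewrite in_itv /= t0 lexx.
  by change (c t = x); rewrite -(chartK (dom_c _ tt)) ex chartK.
rewrite [LHS]eq [RHS]eq; apply: eq_bigr => i _; congr (_ *: _).
have dl s : s \in `[0, t] -> is_derive s 1 (fun s => l i (chart x (c s))) 0.
  move=> st.
  have dli : differentiable (l i) ((chart x \o c) s) by exact: differentiable_linear.
  apply: DeriveDef; first by apply/derivable1_diffP; exact: (differentiable_comp (dc s st) dli).
  have := derive_comp (1 : R) (dc s st) dli; rewrite -[_ \o _]/(fun s => l i (chart x (c s))) => ->.
  by rewrite D1 // derive0.
have [->|tn0] := eqVneq t 0; first by rewrite /c scale0r (sa_0 sa).
have t0' : 0 < t by rewrite lt_neqAle eq_sym tn0.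
pose f (s : R) : R := l i (chart x (c s)).
have h1 (s : R) : s \in `]0, t[ -> is_derive s 1 f 0.
  by move=> st; apply: dl; apply: subset_itvW st.
have h2 : {within `[0, t], continuous f}.
  by apply: derivable_within_continuous => s st; have [] := dl s st.
have [z _] := MVT t0' h1 h2.
by rewrite /f mul0r => /eqP; rewrite subr_eq0 /c scale0r (sa_0 sa) => /eqP.
Qed.

Lemma act_natmul s x : act s x = x -> forall N, act (s *+ N) x = x.
Proof. by move=> h; elim=> [|N IH]; rewrite ?mulr0n ?(sa_0 sa) // mulrS (sa_D sa) IH. Qed.

Lemma act_opp s x : act s x = x -> act (- s) x = x.
Proof. by move=> h; rewrite -{1}h -(sa_D sa) addNr (sa_0 sa). Qed.

(* The orbit is constant for small times, hence for all times by the group law. *)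
Lemma velocity0_fix x xi : velocity xi x = 0 -> forall t : R, act (t *: xi) x = x.
Proof.
move=> /velocity0_small[d d0 hd].
suff pos (t : R) : 0 <= t -> act (t *: xi) x = x.
  move=> t; have [/pos//|t0] := leP 0 t.
  rewrite -[t]opprK scaleNr; apply: act_opp; by apply: pos; rewrite oppr_ge0 ltW.
move=> t0; set N := Num.Def.archi_bound (t / d).
have hN : t / d < N%:R by apply: archi_boundP; rewrite divr_ge0 // ltW.
have N0 : 0 < (N%:R : R) by apply: le_lt_trans hN; rewrite divr_ge0 // ltW.
rewrite (_ : t *: xi = ((t / N%:R) *: xi) *+ N); last first.
  by rewrite -scaler_nat scalerA mulrC divfK // gt_eqF.
apply: act_natmul; apply: hd; rewrite divr_ge0 ?ler0n //=.
by rewrite ltr_pdivrMr // mulrC -ltr_pdivrMr.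
Qed.

Definition zero_interior xi : set X := [set x | \forall y \near x, velocity xi y = 0].

Lemma open_zero_interior xi : open (zero_interior xi).
Proof. exact: open_interior. Qed.

(** In a Hausdorff space the fixed points of [act (t *: xi)] form a closed set. *)
Lemma closure_zero_fix xi x (t : R) : closure (zero_interior xi) x -> act (t *: xi) x = x.
Proof.
move=> clx; apply/eqP/negPn/negP => neq.
have := @cm_hausdorff R n X; rewrite open_hausdorff => /(_ _ _ neq)[[A B] /=].
rewrite !inE => -[Ax Bx] [oA oB AB].
have nA : \forall y \near x, A (act (t *: xi) y).
  by apply: (@act_continuousr (t *: xi) x); exact: open_nbhs_nbhs.
have nB : nbhs x B by exact: open_nbhs_nbhs.
have [y [/nbhs_singleton y0 [Ay By]]] := clx _ (filterI nA nB).
have : (A `&` B) y by split => //; rewrite -(velocity0_fix y0 t).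
by rewrite AB.
Qed.

(* The derivative of the flow is the identity on the interior of the zero set of
   the field, hence on its closure by continuity. *)
Lemma closure_zero_derive xi x (t : R) v : closure (zero_interior xi) x ->
  'D_(0, v) (G x x) (t *: xi, chart x x) = v.
Proof.
move=> clx; have fx := closure_zero_fix t clx; have dx := dom_self x.
have dfx : dom x (act (t *: xi) x) by rewrite fx.
pose H w := 'D_(0, v) (G x x) (t *: xi, w).
have cH : {for chart x x, continuous H}.
  apply: (@continuous_comp _ _ _ (fun w : Cn R n => (t *: xi, w)) ('D_(0, v) (G x x))).
    exact: differentiable_continuous (differentiable_pairr _ _).
  exact: G_dcts dx dfx.
have HS y : zero_interior xi y -> dom x y -> H (chart x y) = v.
  move=> Sy dy; have fy : act (t *: xi) y = y by apply: velocity0_fix; exact: nbhs_singleton Sy.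
  rewrite /H -act_chart_derive ?fy //.
  rewrite -[RHS](@derive_id _ _ (chart x y) v); apply: near_eq_derive.
  move: (near_chartV dy (open_nbhs_nbhs (conj (open_zero_interior xi) Sy))) (near_chartVK dy).
  apply: filterS2 => z /nbhs_singleton z0 dz /=.
  by rewrite velocity0_fix // chartVK.
apply/eqP; rewrite -subr_eq0 -normr_le0; apply/ler_addgt0Pl => e e0; rewrite addr0.
have : \forall y \near x, `|H (chart x x) - H (chart x y)| < e.
  by apply: (near_chart dx (P := fun z => `|H (chart x x) - H z| < e)); move/cvgrPdist_lt : cH; exact.
move=> /(filterI (near_dom dx))/clx[y [Sy [dy]]].
by rewrite (HS y Sy dy) => /ltW.
Qed.

(* Near a point of the closure, the velocity [t |-> D(act (t xi)) V] of the orbit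
   stays so close to [V] that the largest coordinate of [V] never vanishes along
   the orbit; on a periodic orbit this contradicts Rolle's theorem unless [V = 0]. *)
Lemma closed_zero_interior xi (T : R) : 0 < T -> (forall x, act (T *: xi) x = x) ->
  closed (zero_interior xi).
Proof.
move=> T0 per x clx; have dx := dom_self x.
have [N [e [l [lc ll eq]]]] := @findim_Cn R n.
(* Each of the [N] coordinates will contribute an error of at most [eps] times the largest one, and
   [N * eps < 1] then forces that one to vanish. *)
pose eps : R := N.+1%:R^-1.
have eps0 : 0 < eps by rewrite invr_gt0 ltr0Sn.
pose D i t y := 'D_(0, e i) (G x x) (t *: xi, chart x y).
pose P y t := dom x (act (t *: xi) y) /\
  forall i j, `|l j (e i) - l j (D i t y)| < eps.
have nearP t : `[0, T]%classic t -> \forall t' \near t & y \near x, P y t'.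
  move=> _; have fx := closure_zero_fix t clx.
  have dfx : dom x (act (t *: xi) x) by rewrite fx.
  have cxi : {for (t, x), continuous (fun ty : R * X => ty.1 *: xi)}.
    apply: (@continuous_comp _ _ _ fst (fun t : R => t *: xi)); first exact: cvg_fst.
    exact: scalel_continuous.
  have cact : {for (t, x), continuous (fun ty : R * X => act (ty.1 *: xi) ty.2)}.
    apply: (@continuous_comp _ _ _ (fun ty : R * X => (ty.1 *: xi, ty.2))
      (fun sx : E * X => act sx.1 sx.2)); last exact: act_continuous.
    apply: cvg_pair => /=; last exact: cvg_snd.
    exact: cxi.
  have n1 : \forall ty \near (t, x), dom x (act (ty.1 *: xi) ty.2).
    by apply: cact; rewrite /= fx; exact: near_dom.
  have n2 i j : \forall ty \near (t, x), `|l j (e i) - l j (D i ty.1 ty.2)| < eps.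
    have cD : {for (t, x), continuous (fun ty : R * X => l j (D i ty.1 ty.2))}.
      apply: (@continuous_comp _ _ _ (fun ty : R * X => D i ty.1 ty.2) (l j)); last exact: lc.
      apply: (@continuous_comp _ _ _ (fun ty : R * X => (ty.1 *: xi, chart x ty.2))
        ('D_(0, e i) (G x x))); last exact: G_dcts dx dfx.
      apply: continuous_pair; first exact: cxi.
      apply: (@continuous_comp _ _ _ snd (chart x)); first exact: cvg_snd.
      exact: chart_continuous dx.
    move/cvgrPdist_lt : cD => /(_ _ eps0).
    by apply: filterS => ty; rewrite /= [D i t x]closure_zero_derive.
  have n3 : \forall ty \near (t, x), forall i j, `|l j (e i) - l j (D i ty.1 ty.2)| < eps.
    have n3 i : nbhs (t, x) [set ty | forall j, `|l j (e i) - l j (D i ty.1 ty.2)| < eps].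
      exact: (@filter_forall _ _ (fun j => [set ty : R * X | `|l j (e i) - l j (D i ty.1 ty.2)| < eps])
        (nbhs (t, x)) _ (n2 i)).
    exact: (@filter_forall _ _ (fun i => [set ty : R * X | forall j, `|l j (e i) - l j (D i ty.1 ty.2)| < eps])
        (nbhs (t, x)) _ n3).
  exact: (filterI n1 n3).
(* Compactness of a period makes the neighbourhood of [x] uniform in time. *)
have nP : \forall y \near x, `[0, T]%classic `<=` P y.
  by apply: ((compact_near_coveringP _).1 (@segment_compact _ 0 T)).
move: nP (near_dom dx); apply: filterS2 => y hP dy.
have hc (t : R) : t \in `[0, T] -> P y t by move=> tT; exact: hP.
pose V := der (chart x) y (velocity xi y).
suff V0 : V = 0.
  rewrite -(Ktvec (velocity xi y) dy) -/V V0.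
  have /linP[F <-] := tvec_linear dy; exact: linear0.
pose c (t : R) := act (t *: xi) y.
have dc t : t \in `[0, T] -> differentiable (chart x \o c) t.
  by move=> /hc[st _]; exact: flow_diff.
have D1 t : t \in `[0, T] -> 'D_1 (chart x \o c) t = \sum_i l i V *: D i t y.
  move=> /hc[st _]; rewrite (flow_derive st) -[velocity xi y](Ktvec _ dy) -/V.
  rewrite -(der_chart _ dy (act_mdiff st)) (act_chart_derive _ dy st).
  rewrite -derive_sum_dir; last exact: G_diff dy st.
  congr ('D_ _ _ _); rewrite {1}(eq V).
  elim/big_rec2 : _ => // i a b _ <-.
  by congr pair => /=; rewrite ?scaler0 ?addr0.
have [N0|[i0 _]] : (forall i : 'I_N, False) \/ (exists i : 'I_N, True).
- by have [h|h] := pselect (exists i : 'I_N, True); [right|left => i; apply: h; exists i].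
- by rewrite (eq V) big1 // => i; case: (N0 i).
have [j _ jmax] := @arg_maxP _ _ _ i0 xpredT (fun i => `|l i V|) isT.
have [t tT [_ dt]] : exists2 t, t \in `]0, T[ & is_derive t 1 (fun t => l j (chart x (c t))) 0.
  have dl t : t \in `[0, T] -> derivable (fun t => l j (chart x (c t))) t 1.
    move=> tT; apply/derivable1_diffP.
    exact: (differentiable_comp (dc t tT) (differentiable_linear _ (lc j) (ll j))).
  apply: Rolle => //.
  - by move=> t tT; apply: dl; apply: subset_itvW tT.
  - exact: derivable_within_continuous.
  - by rewrite /c per scale0r (sa_0 sa).
have tT' : t \in `[0, T] by apply: subset_itvW tT.
have := derive_comp (1 : R) (dc t tT') (differentiable_linear _ (lc j) (ll j)).
rewrite [LHS]dt (derive_linear _ _ (lc j) (ll j)) D1 // => sum0.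
have {}sum0 : \sum_i l i V * l j (D i t y) = 0.
  rewrite [RHS]sum0; have [F eF] := linP (ll j); rewrite -eF linear_sum.
  by apply: eq_bigr => i _; rewrite linearZ.
(* The Rolle sum [sum0] is subtracted so that only the deviations of [D i t y] from [e i] remain,
   each of them smaller than [eps]. *)
have eV : l j V = \sum_i l i V * (l j (e i) - l j (D i t y)).
  rewrite -[LHS]subr0 -[in LHS]sum0 {1}(eq V).
  have [F eF] := linP (ll j); rewrite -eF linear_sum -sumrB.
  by apply: eq_bigr => i _; rewrite linearZ mulrBr.
have le1 : `|l j V| <= N%:R * eps * `|l j V|.
  rewrite {1}eV; apply: le_trans (ler_norm_sum _ _ _) _.
  apply: (@le_trans _ _ (\sum_(i < N) eps * `|l j V|)).
    apply: ler_sum => i _; rewrite normrM mulrC; apply: ler_pM => //.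
      by apply: ltW; have [_] := hc t tT'; exact.
    exact: jmax.
  by rewrite sumr_const card_ord -mulrA mulr_natl.
have lj0 : l j V = 0.
  apply/eqP; rewrite -normr_eq0; apply/eqP/le_anti; rewrite normr_ge0 andbT.
  move: le1; rewrite -subr_le0 -{1}[`|l j V|]mul1r -mulrBl pmulr_rle0 //.
  by rewrite subr_gt0 ltr_pdivrMr ?ltr0Sn // mul1r ltr_nat.
rewrite (eq V) big1 // => i _; have : `|l i V| <= `|l j V| := jmax i isT.
by rewrite lj0 normr0 normr_le0 => /eqP ->; rewrite scale0r.
Qed.

Lemma periodic_zero xi (T : R) : 0 < T -> (forall x, act (T *: xi) x = x) ->
  zero_interior xi !=set0 -> forall x, velocity xi x = 0.
Proof.
move=> T0 per ne x.
have h : zero_interior xi = setT.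
  apply: (@cm_connected R n X _ ne); exists (zero_interior xi); rewrite ?setTI //.
  - exact: open_zero_interior.
  - exact: closed_zero_interior per.
have : zero_interior xi x by rewrite h.
exact: nbhs_singleton.
Qed.

End Actions.

(** * Torus actions *)

Section Dirichlet.
Context {R : realType}.

Lemma rV_norm_lt k (u : 'rV[R]_k) (e : R) : 0 < e -> (forall j, `|u 0 j| < e) -> `|u| < e.
Proof.
move=> e0 h; rewrite /Num.Def.normr /= mx_normrE; apply: bigmax_lt => // -[i j] _ /=.
by rewrite ord1.
Qed.

(** Pigeonhole: the fractional parts of the [M ^ k + 1] first multiples of [c] fall into [M ^ k]
    cubes of side [1 / M], so two multiples share a cube, and their difference is close to an
    integer vector. *)
Lemma dirichlet k (c : 'rV[R]_k) (e : R) : 0 < e ->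
  exists N (p : 'rV[int]_k), (0 < N)%N /\ `|N%:R *: c - map_mx intr p| < e.
Proof.
move=> e0; set M := (Num.Def.archi_bound e^-1).+1.
have Me : M%:R^-1 < e.
  rewrite -[e]invrK ltf_pV2 ?posrE ?invr_gt0 ?ltr0Sn //.
  apply: lt_trans (_ : (Num.Def.archi_bound e^-1)%:R < _); last by rewrite ltr_nat.
  by apply: archi_boundP; rewrite invr_ge0 ltW.
have M0 : 0 < (M%:R : R) by rewrite ltr0Sn.
pose fr (x : R) := x - (Num.floor x)%:~R.
have fr0 x : 0 <= fr x by rewrite subr_ge0 floor_le.
have fr1 x : fr x < 1 by rewrite ltrBlDl; have := floorD1_gt x; rewrite intrD addrC.
pose cell (i : nat) (j : 'I_k) := Num.trunc (M%:R * fr (i%:R * c 0 j)).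
have cellM i j : (cell i j < M)%N.
  rewrite -(ltr_nat R); apply: le_lt_trans (_ : M%:R * fr (i%:R * c 0 j) < _).
    by have /truncn_itv/andP[] : 0 <= M%:R * fr (i%:R * c 0 j) by rewrite mulr_ge0 // ltW.
  by rewrite -[ltRHS]mulr1 ltr_pM2l.
pose g (i : 'I_(M ^ k).+1) : {ffun 'I_k -> 'I_M} := [ffun j => Ordinal (cellM i j)].
have /injectivePn[i [i' ne gii']] : ~~ injectiveb g.
  apply/negP => /injectiveP/leq_card.
  by rewrite card_ffun !card_ord ltnn.
wlog lt : i i' ne gii' / (i < i')%N.
  move=> H; have := ne; rewrite -val_eqE neq_ltn => /orP[/H|]; first exact.
  by move=> /H; apply; rewrite // eq_sym.
exists (i' - i)%N, (\row_j (Num.floor (i'%:R * c 0 j) - Num.floor (i%:R * c 0 j))).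
split; first by rewrite subn_gt0.
apply: lt_trans (Me); apply: rV_norm_lt; first by rewrite invr_gt0.
move=> j; rewrite !mxE natrB 1?ltnW // mulrBl intrB.
rewrite (_ : _ - _ = fr (i'%:R * c 0 j) - fr (i%:R * c 0 j)); last by rewrite /fr; ring.
have := congr1 (fun h : {ffun 'I_k -> 'I_M} => val (h j)) gii'; rewrite !ffunE /= => ce.
have tr (l : nat) : (cell l j)%:R <= M%:R * fr (l%:R * c 0 j) < (cell l j).+1%:R.
  by apply: truncn_itv; rewrite mulr_ge0 // ltW.
rewrite -(ltr_pM2l M0) divff ?gt_eqF // -[M%:R in X in X < _]ger0_norm ?ltW // -normrM mulrBr.
move: (tr i) (tr i'); rewrite -ce -natr1 => /andP[a1 a2] /andP[b1 b2].
by rewrite ltr_norml; apply/andP; split; lra.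
Qed.

End Dirichlet.

Section BaireCn.
Context {R : realType} {n : nat}.

(** The statement is transported through the linear homeomorphism between [Cn R n] and row vectors
    of length [n + n], which carry the complete normed structure that [Baire] asks for. *)
Lemma Baire_Cn (F : nat -> set (Cn R n)) :
  (forall i, open (F i) /\ dense (F i)) -> dense (\bigcap_i F i).
Proof.
move=> h.
pose T : completeNormedModType R := HB.pack ('rV[R]_(n + n)).
pose j (u : T) : Cn R n := (lsubmx u, rsubmx u).
pose jV (w : Cn R n) : T := row_mx w.1 w.2.
have cj : continuous j.
  apply: findim_linear_continuous; first exact: (@findim_rV R (n + n)).
  by move=> c u v; rewrite /j; congr pair; rewrite linearP.
have cjV : continuous jV.
  apply: findim_linear_continuous; first exact: findim_Cn.
  by move=> c u v; rewrite /jV scale_row_mx add_row_mx.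
have jK w : j (jV w) = w by case: w => a b; rewrite /j /jV row_mxKl row_mxKr.
have jVK u : jV (j u) = u by rewrite /jV /j hsubmxK.
have oj (A : set (Cn R n)) : open A -> open (j @^-1` A).
  by move=> oA; apply: open_comp => // u _; exact: cj.
have ojV (A : set T) : open A -> open (jV @^-1` A).
  by move=> oA; apply: open_comp => // u _; exact: cjV.
have hF i : open (j @^-1` F i) /\ dense (j @^-1` F i).
  have [oF dF] := h i; split; first exact: oj.
  move=> O [u Ou] /ojV oO.
  have [|w [Ow Fw]] := dF _ _ oO; first by exists (j u); rewrite /= jVK.
  by exists (jV w); split => //=; rewrite jK.
move=> O [w Ow] /oj oO.
have [|u [Ou Fu]] := @Baire R T _ hF _ _ oO; first by exists (jV w); rewrite /= jK.
by exists (j u); split => // i _; exact: Fu.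
Qed.

End BaireCn.

Section Torus.
Context {R : realType} {n k : nat} {X : complexManifold R n}.
Context {act : 'rV[R]_k -> X -> X} (sa : smooth_action act).
Context (per : forall j x, act ((2 * pi) *: delta_mx 0 j) x = x).

Lemma act_add s t x : act s x = x -> act t x = x -> act (s + t) x = x.
Proof. by move=> hs ht; rewrite (sa_D sa) ht. Qed.

Lemma act_period (p : 'rV[int]_k) x : act ((2 * pi) *: map_mx intr p) x = x.
Proof.
rewrite [map_mx _ _]row_sum_delta scaler_sumr.
elim/big_ind : _ => [|s t|j _]; [exact: (sa_0 sa)|exact: act_add|].
rewrite mxE scalerA mulrC -scalerA.
case: (p 0 j) => m.
  by rewrite -pmulrn scaler_nat; apply: (act_natmul sa).
by rewrite NegzE mulrNz scaleNr -pmulrn scaler_nat; apply: (act_opp sa); apply: (act_natmul sa).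
Qed.

(* The stabilizer of [x] is discrete modulo its Lie algebra, so that an integer
   vector which is close enough to the Lie algebra belongs to it. *)
Lemma integer_velocity0 x (c : 'rV[R]_k) : velocity (act := act) c x = 0 -> c != 0 ->
  exists2 p : 'rV[int]_k, p != 0 & velocity (act := act) (map_mx intr p) x = 0.
Proof.
move=> vc c0.
have [L eL] := linP (velocity_linear sa x).
pose Li := ((linfun L)^-1)%VF.
have LK s : L (Li (L s)) = L s.
  by rewrite -!(lfunE L) limg_lfunVK // memv_img ?memvf.
have eLs s : velocity (act := act) s x = L s by rewrite eL.
have cLi : continuous Li by apply: findim_linear_continuous; [exact: findim_Cn|exact: linearP].
have cL : continuous L by apply: findim_linear_continuous; [exact: findim_rV|exact: linearP].
pose h s := Li (chart x (act s x)).
have dor : differentiable (fun s => chart x (act s x)) 0.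
  by apply: (orbit_diff sa (dom_self x)); rewrite (sa_0 sa); exact: dom_self.
have dLi y : differentiable Li y by apply: differentiable_linear => //; exact: linearP.
have dh : differentiable h 0 by exact: (differentiable_comp dor (dLi _)).
have Dh s : 'd h 0 s = Li (L s).
  rewrite -deriveE // (derive_comp s dor (dLi _)) derive_linear //; last exact: linearP.
  by rewrite -eLs.
(* The image of [Li \o L] is a complement of the isotropy algebra, on which the differential of [h]
   at 0 is the identity. If [w] there fixes [x], then [h] takes the same value at [w] and at 0, so
   the remainder bound reads [|w| <= |w| / 2]. *)
have small : \forall w \near (0 : 'rV[R]_k), act w x = x -> Li (L w) = w -> w = 0.
  have /eqaddoP/(_ (2^-1)) := diff_locally dh.
  rewrite invr_gt0 ltr0n => /(_ isT); apply: filterS => w.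
  rewrite !fctE /= addr0 Dh => hw ax Lw; move: hw; rewrite /h ax (sa_0 sa) Lw.
  rewrite opprD addrA subrr sub0r normrN => hw.
  apply/eqP; rewrite -normr_le0; move: hw; set a := `|w|; lra.
(* Split [s] into [s - Li (L s)], which lies in the isotropy algebra and hence fixes [x], and
   [Li (L s)], to which [small] applies. *)
have : \forall s \near (0 : 'rV[R]_k), act s x = x -> L s = 0.
  have cLL : {for 0, continuous (fun s => Li (L s))}.
    by apply: continuous_comp; [exact: cL|exact: cLi].
  have n0 : Li (L 0) = 0 by rewrite !linear0.
  have : \forall s \near (0 : 'rV[R]_k), act (Li (L s)) x = x -> Li (L (Li (L s))) = Li (L s) -> Li (L s) = 0.
    by apply: (cLL (fun w => act w x = x -> Li (L w) = w -> w = 0)); rewrite n0.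
  apply: filterS => s hs ax; rewrite -LK hs ?linear0 ?LK //.
  have fix0 : act (s - Li (L s)) x = x.
    have v0 : velocity (act := act) (s - Li (L s)) x = 0 by rewrite eLs linearB LK subrr.
    by have := velocity0_fix sa v0 1; rewrite scale1r.
  rewrite (_ : Li (L s) = s - (s - Li (L s))); last by rewrite opprB addrC subrK.
  by apply: act_add => //; exact: (act_opp sa).
move=> /nbhs_ballP[d /= d0 hd].
(* The bound [d / (2 * pi)] brings [2 * pi] times the error of approximation into the ball of radius
   [d]. The bound [|c|] excludes [p = 0], for which the error would be [N * |c|]. *)
pose e := Num.min `|c| (d / (2 * pi)).
have pi2 : 0 < 2 * pi :> R by rewrite mulr_gt0 // pi_gt0.
have e0 : 0 < e by rewrite lt_min normr_gt0 c0 divr_gt0.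
have [N [p [N0]]] := dirichlet c e0.
rewrite lt_min => /andP[lt1 lt2]; exists p.
  apply: contraTneq lt1 => ->; rewrite map_mx0 subr0 normrZ -leNgt.
  by rewrite ger0_norm // ler_peMl // ler1n.
pose s := (2 * pi) *: (N%:R *: c - map_mx intr p).
have Ls : L s = 0.
  apply: hd.
    by rewrite -ball_normE /= sub0r normrN normrZ gtr0_norm // mulrC -ltr_pdivlMr.
  rewrite /s scalerBr; apply: act_add; last by apply: (act_opp sa); exact: act_period.
  by rewrite scalerA; exact: (velocity0_fix sa).
move: Ls; rewrite /s linearZ linearB linearZ -!eLs vc /= scaler0 sub0r => /eqP.
by rewrite scaler_eq0 (negbTE (lt0r_neq0 pi2)) oppr_eq0 => /eqP.
Qed.

(** [velocity] reads each vector in the chart attached to its own point. The right-hand side uses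
    the fixed chart [q], in which the field depends continuously on the point. *)
Lemma velocity_eq0_chart q x xi : dom q x ->
  velocity (act := act) xi x = 0 <->
  'D_(xi, 0) (fun sz : 'rV[R]_k * Cn R n => chart q (act sz.1 (chartV q sz.2)))
     (0, chart q x) = 0.
Proof.
move=> dq; have dq' : dom q (act 0 x) by rewrite (sa_0 sa).
rewrite -(orbit_derive sa xi dq dq') (der_velocity sa); last exact: mdiff_chart_fun.
have [F eF] := linP (der_linear (mdiff_chart_fun dq)).
split => [->|h]; first by rewrite -eF linear0.
have [T eT] := linP (tvec_linear dq).
by rewrite -(Ktvec (velocity xi x) dq) h -eT linear0.
Qed.

(** By [integer_velocity0] a ball inside [O] is covered by the zero sets of the fields of the
    nonzero integer vectors. These closed sets are countably many, so by Baire one of them has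
    interior. *)
Lemma dependent_open_zero (O : set X) : open O -> O !=set0 ->
  (forall x, O x -> exists2 c, c != 0 & velocity (act := act) c x = 0) ->
  exists2 p : 'rV[int]_k, p != 0 & zero_interior (act := act) (map_mx intr p) !=set0.
Proof.
move=> oO [q Oq] hO; have dq := dom_self q.
pose W := chart q @` (dom q `&` O).
have oW : open W by exact: open_img.
have Wq : W (chart q q) by exists q.
have [r /= r0 rW] : exists2 r : R, 0 < r & closed_ball (chart q q) r `<=` W.
  have /nbhs_ballP[r /= r0 rW] := open_nbhs_nbhs (conj oW Wq).
  exists (r / 2); first by rewrite divr_gt0.
  exact: subset_trans (subset_closure_half r0) rW.
pose Phi (p : 'rV[int]_k) (w : Cn R n) :=
  'D_(map_mx intr p, 0) (fun sz : 'rV[R]_k * Cn R n => chart q (act sz.1 (chartV q sz.2))) (0, w).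
have cPhi p w : W w -> {for w, continuous (Phi p)}.
  move=> [x [dx _] <-].
  apply: (@continuous_comp _ _ _ (fun w : Cn R n => (0, w)) ('D_(map_mx intr p, 0) _)).
    exact: differentiable_continuous (differentiable_pairr _ _).
  have dqx : dom q (act 0 x) by rewrite (sa_0 sa).
  exact: (G_dcts sa dx dqx).
(* [Phi p] is known to be continuous on [W] only; intersecting with a closed ball inside [W] makes
   [F p] open in the whole space. *)
pose F p := ~` (closed_ball (chart q q) r `&` [set w | Phi p w = 0]).
have oF p : open (F p).
  rewrite openE => w /not_andP; have [Bw|nBw _] := pselect (closed_ball (chart q q) r w).
    move=> [//|nPw]; have /eqP Pn0 := nPw.
    have : \forall z \near w, Phi p z != 0.
      have /cvgrPdist_lt/(_ `|Phi p w|) := cPhi p w (rW _ Bw).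
      rewrite normr_gt0 => /(_ Pn0); apply: filterS => z.
      by apply: contraTneq => ->; rewrite subr0 ltxx.
    by apply: filterS => z /eqP Pz [].
  have : open (~` closed_ball (chart q q) r) by exact/closed_openC/closed_ball_closed.
  rewrite openE => /(_ _ nBw); by apply: filterS => z nz [/nz].
apply: contrapT => noz.
have dF p : p != 0 -> dense (F p).
  move=> p0 A [w Aw] oA; apply: contrapT => AF; apply: noz; exists p => //.
  have sA z : A z -> closed_ball (chart q q) r z /\ Phi p z = 0.
    by move=> Az; apply: contrapT => nz; apply: AF; exists z.
  have [x [dx Ox] ex] := rW _ (sA w Aw).1.
  exists x; rewrite /zero_interior /=.
  have : \forall y \near x, A (chart q y).
    by apply: (chart_continuous dx); rewrite ex; exact: open_nbhs_nbhs.
  move=> /(filterI (near_dom dx)); apply: filterS => y [dy /sA[_ Py]].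
  exact/(velocity_eq0_chart _ dy).
(* The vector 0 must be discarded, its field being zero everywhere. *)
pose Fn (i : nat) := if unpickle i is Some p then if p == 0 then setT else F p else setT.
have dFn : dense (\bigcap_i Fn i).
  have dT : dense [set: Cn R n] by move=> A [z Az] _; exists z.
  apply: Baire_Cn => i; rewrite /Fn; case: (unpickle i) => [p|]; last by split; [exact: openT|].
  by have [_|p0] := eqVneq p 0; [split; [exact: openT|]|split; [exact: oF|exact: dF]].
have [|w [Bw Fw]] := dFn (ball (chart q q) r) _ (ball_open _ _).
  by exists (chart q q); exact: ballxx.
have Bw' := subset_closed_ball Bw.
have [x [dx Ox] ex] := rW _ Bw'.
have [c c0 vc] := hO x Ox.
have [p p0 vp] := integer_velocity0 vc c0.
have FnE : Fn (pickle p) = F p by rewrite /Fn pickleK (negbTE p0).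
have := Fw (pickle p) I; rewrite FnE => nF; apply: nF; split; first exact: Bw'.
suff -> : w = chart q x by apply: (velocity_eq0_chart (map_mx intr p) dx).1.
by rewrite ex.
Qed.

(* A weak form of the principal orbit theorem for tori. *)
Lemma dependent_torus_action (O : set X) : open O -> O !=set0 ->
  (forall x, O x -> exists2 c, c != 0 & velocity (act := act) c x = 0) ->
  exists2 p : 'rV[int]_k, p != 0 & forall x, velocity (act := act) (map_mx intr p) x = 0.
Proof.
move=> oO neO /(dependent_open_zero oO neO)[p p0 zp]; exists p => //.
apply: (periodic_zero sa (T := 2 * pi) _ _ zp); first by rewrite mulr_gt0 // pi_gt0.
exact: act_period.
Qed.

End Torus.

(** * Hermitian linear algebra *)

Section ComplexCoordinates.
Context {R : realType}.
Local Notation Cx := (@Complex R).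

Lemma CxD a b c d : Cx a b + Cx c d = Cx (a + c) (b + d).
Proof. by []. Qed.

Lemma CxM a b c d : Cx a b * Cx c d = Cx (a * c - b * d) (a * d + b * c).
Proof. by []. Qed.

Definition rC (a : R) : R[i] := Cx a 0.

Lemma rC_additive : additive rC.
Proof. by move=> a b; rewrite /rC -[RHS]/(Cx (a - b) (0 - 0)) subrr. Qed.

Lemma rC_monoid : monoid_morphism rC.
Proof. by split => // a b; rewrite /rC CxM !mulr0 !mul0r subr0 addr0. Qed.

HB.instance Definition _ := GRing.isAdditive.Build R R[i] rC rC_additive.
HB.instance Definition _ := GRing.isMonoidMorphism.Build R R[i] rC rC_monoid.

Lemma ReZ (a : R) (z : R[i]) : complex.Re (rC a * z) = a * complex.Re z.
Proof. by case: z => x y; rewrite /rC CxM /= mul0r subr0. Qed.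

Lemma ImZ (a : R) (z : R[i]) : complex.Im (rC a * z) = a * complex.Im z.
Proof. by case: z => x y; rewrite /rC CxM /= mul0r addr0. Qed.

Lemma ReD (z w : R[i]) : complex.Re (z + w) = complex.Re z + complex.Re w.
Proof. by case: z => a b; case: w. Qed.

Lemma Re_sum N (z : 'I_N -> R[i]) : complex.Re (\sum_i z i) = \sum_i complex.Re (z i).
Proof. by elim/big_ind2 : _ => // x1 x2 y1 y2 <- <-; rewrite ReD. Qed.

Lemma CxE z : z = rC (complex.Re z) + Cx 0 1 * rC (complex.Im z).
Proof. by case: z => a b; rewrite /rC CxM CxD !(mul0r, mul1r, mulr0, subrr, addr0, add0r). Qed.

Context {n : nat}.

Definition ofC (r : 'rV[R[i]]_n) : Cn R n :=
  (\row_j complex.Re (r 0 j), \row_j complex.Im (r 0 j)).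

Lemma ofCK r : toC (ofC r) = r.
Proof. by apply/rowP => j; rewrite !mxE; case: (r 0 j). Qed.

Lemma toCK (u : Cn R n) : ofC (toC u) = u.
Proof. by case: u => a b; congr pair; apply/rowP => j; rewrite !mxE. Qed.

Lemma toC_inj (u v : Cn R n) : toC u = toC v -> u = v.
Proof. by move=> h; rewrite -[u]toCK h toCK. Qed.

Lemma toCD (u v : Cn R n) : toC (u + v) = toC u + toC v.
Proof. by apply/rowP => j; rewrite !mxE. Qed.

Lemma toCZ (a : R) (u : Cn R n) : toC (a *: u) = rC a *: toC u.
Proof. by apply/rowP => j; rewrite !mxE /rC CxM !mul0r subr0 addr0. Qed.

Lemma toC_mulI (u : Cn R n) : toC (mulI u) = Cx 0 1 *: toC u.
Proof. by apply/rowP => j; rewrite !mxE CxM !mul0r !mul1r sub0r add0r. Qed.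

Lemma toC0 : toC (0 : Cn R n) = 0.
Proof. by apply/rowP => j; rewrite !mxE. Qed.

Lemma toC_sum N (u : 'I_N -> Cn R n) : toC (\sum_i u i) = \sum_i toC (u i).
Proof. by elim/big_ind2 : _ => [|x1 x2 y1 y2 <- <-|//]; [exact: toC0|rewrite toCD]. Qed.

Lemma mulI_linear : linear (@mulI R n).
Proof.
move=> c [a b] [a' b']; rewrite /mulI /=; congr pair => /=.
by rewrite opprD scalerN.
Qed.

Lemma mulI2K (u : Cn R n) : mulI (mulI u) = - u.
Proof. by case: u => a b. Qed.

Lemma toC_comb N (a b : 'I_N -> R) (v : 'I_N -> Cn R n) :
  toC (\sum_i a i *: v i + mulI (\sum_i b i *: v i))
  = \sum_i Cx (a i) (b i) *: toC (v i).
Proof.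
rewrite toCD toC_mulI !toC_sum scaler_sumr -big_split; apply: eq_bigr => i _.
by rewrite /= !toCZ scalerA -scalerDl /rC CxM CxD !(mul0r, mul1r, mulr0, subrr, addr0, add0r).
Qed.

Lemma complex_linear_expand (al : Cn R n -> R[i]) :
  (forall a u v, al (a *: u + v) = rC a * al u + al v) ->
  (forall u, al (mulI u) = Cx 0 1 * al u) ->
  forall u, al u = \sum_j toC u 0 j * al (unit_vec R j).
Proof.
move=> lin J.
have al0 : al 0 = 0.
  have := lin 1 0 0; rewrite scale1r addr0 (_ : rC 1 = 1) // mul1r => /eqP.
  by rewrite -subr_eq subrr eq_sym => /eqP.
have alD u v : al (u + v) = al u + al v.
  by have := lin 1 u v; rewrite scale1r (_ : rC 1 = 1) // mul1r.
have alZ a u : al (a *: u) = rC a * al u by have := lin a u 0; rewrite !addr0 al0 addr0.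
have alS N (u : 'I_N -> Cn R n) : al (\sum_i u i) = \sum_i al (u i).
  by elim/big_ind2 : _ => // x1 x2 y1 y2 <- <-.
move=> u.
have -> : u = \sum_j u.1 0 j *: unit_vec R j + mulI (\sum_j u.2 0 j *: unit_vec R j).
  have e (x : 'rV[R]_n) : \sum_j x 0 j *: unit_vec R j = (x, 0).
    rewrite [in RHS](row_sum_delta x).
    elim/big_rec2 : _ => // i y1 y2 _ ->; rewrite /unit_vec.
    by congr pair => /=; rewrite scaler0 addr0.
  by rewrite !e /mulI /=; case: u => a b; congr pair => /=; rewrite ?oppr0 ?addr0 ?add0r.
rewrite alD J !alS mulr_sumr -big_split; apply: eq_bigr => j _.
rewrite toC_comb /= !alZ mulrA -mulrDl; congr (_ * _).
rewrite summxE (bigD1 j) //= big1 => [|i ij].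
  by rewrite !mxE !eqxx /= /rC !CxM !CxD !(mul0r, mul1r, mulr1, mulr0, subrr, subr0, addr0, add0r).
by rewrite !mxE (negbTE (_ : j != i)) 1?eq_sym // ?eqxx /= CxM !mulr0 subrr addr0.
Qed.

End ComplexCoordinates.

Section LinearAlgebra.
Context {R : realType}.

(** Duality: the image is everything when no nonzero functional annihilates it. *)
Lemma linear_surj (E : normedModType R) N (L : E -> 'rV[R]_N) :
  findim E -> linear L ->
  (forall a : 'I_N -> R, (forall u, \sum_i a i * L u 0 i = 0) -> forall i, a i = 0) ->
  forall w, exists u, L u = w.
Proof.
move=> [N' [e [l [_ _ eq]]]] /linP[F eF] h w.
pose M := \matrix_i F (e i).
have FM u : F u = (\row_i l i u) *m M.
  rewrite {1}(eq u) linear_sum mulmx_sum_row; apply: eq_bigr => i _.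
  by rewrite linearZ /= rowK mxE.
have : row_free M^T.
  rewrite -kermx_eq0; apply/eqP/eqP/rowV0P => a; rewrite sub_kermx => /eqP aM.
  apply/rowP => i; rewrite mxE; apply: (h (fun i => a 0 i)) => u.
  have : F u *m a^T = 0 by rewrite FM -mulmxA -[M]trmxK -trmx_mul aM trmx0 mulmx0.
  by move=> /matrixP/(_ 0 0); rewrite !mxE => H; rewrite -[RHS]H -eF; apply: eq_bigr => j _; rewrite mxE mulrC.
rewrite /row_free mxrank_tr => fM.
have [D ->] : exists D, w = D *m M by apply/submxP; apply: submx_full; rewrite /row_full.
exists (\sum_i D 0 i *: e i); rewrite -eF linear_sum mulmx_sum_row.
by apply: eq_bigr => i _; rewrite linearZ /= rowK.
Qed.

Lemma linear_inj_surj (E : vectType R) (L : {linear E -> E}) :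
  (forall u, L u = 0 -> u = 0) -> forall v, exists u, L u = v.
Proof.
move=> inj v; have k0 : lker (linfun L) == 0%VS.
  by apply/lker0P => x y; rewrite !lfunE => /eqP; rewrite -subr_eq0 -linearB => /eqP/inj/eqP; rewrite subr_eq0 => /eqP.
by exists (((linfun L)^-1)%VF v); rewrite -(lfunE L) lker0_lfunVK.
Qed.

(** The added rows are the last [m] rows of the invertible [row_ebase A]; its first [k] rows give
    those of [A] after multiplication by the invertible [col_ebase A]. *)
Lemma row_free_complete (F : fieldType) k m (A : 'M[F]_(k, k + m)) : row_free A ->
  exists B : 'M[F]_(m, k + m), (\det (col_mx A B) != 0)%R.
Proof.
move=> fA; exists (dsubmx (row_ebase A)).
have rA : \rank A = k by apply/eqP.
have -> : col_mx A (dsubmx (row_ebase A)) = block_mx (col_ebase A) 0 0 1%:M *m row_ebase A.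
  rewrite -[in RHS](vsubmxK (row_ebase A)) mul_block_col !mul0mx add0r mul1mx addr0.
  congr col_mx; have e := mulmx_ebase A; rewrite rA in e.
  rewrite -{1}e -mulmxA; congr (_ *m _).
  by rewrite -{1}(vsubmxK (row_ebase A)) pid_mx_row mul_row_col mul1mx mul0mx addr0.
rewrite det_mulmx det_ublock det1 mulr1 mulf_neq0 // -unitfE -unitmxE.
  exact: col_ebase_unit.
exact: row_ebase_unit.
Qed.

End LinearAlgebra.

(** * Hermitian forms at a point and isotropic frames *)

Section Hermitian.
Context {R : realType} {n : nat}.
Local Notation E := (Cn R n).

(** The part of [is_kahler] that lives at a single point, which lets the same linear algebra serve
    [X] and [Y]. *)
Record hermitian (w : E -> E -> R) : Prop := Hermitian {
  herm_lin : forall c u1 u2 v, w (c *: u1 + u2) v = c * w u1 v + w u2 v;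
  herm_anti : forall u v, w u v = - w v u;
  herm_compat : forall u v, w (mulI u) (mulI v) = w u v;
  herm_pos : forall u, u != 0 -> 0 < w u (mulI u) }.

Context {w : E -> E -> R} (hw : hermitian w).

Lemma hermDl u v x : w (u + v) x = w u x + w v x.
Proof. by have := herm_lin hw 1 u v x; rewrite scale1r mul1r. Qed.

Lemma herm0l x : w 0 x = 0.
Proof. by have /eqP := hermDl 0 0 x; rewrite addr0 -subr_eq subrr eq_sym => /eqP. Qed.

Lemma hermZl c u x : w (c *: u) x = c * w u x.
Proof. by have := herm_lin hw c u 0 x; rewrite herm0l !addr0. Qed.

Lemma hermDr u v x : w x (u + v) = w x u + w x v.
Proof. by rewrite !(herm_anti hw x) hermDl opprD. Qed.

Lemma hermZr c u x : w x (c *: u) = c * w x u.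
Proof. by rewrite !(herm_anti hw x) hermZl mulrN. Qed.

Lemma herm0r x : w x 0 = 0.
Proof. by rewrite (herm_anti hw) herm0l oppr0. Qed.

Lemma herm_sumr N (c : 'I_N -> R) (v : 'I_N -> E) x :
  w x (\sum_i c i *: v i) = \sum_i c i * w x (v i).
Proof.
by elim/big_ind2 : _ => [|x1 x2 y1 y2 <- <-|i _]; rewrite ?herm0r ?hermDr ?hermZr.
Qed.

Lemma herm_suml N (c : 'I_N -> R) (v : 'I_N -> E) x :
  w (\sum_i c i *: v i) x = \sum_i c i * w (v i) x.
Proof.
by elim/big_ind2 : _ => [|x1 x2 y1 y2 <- <-|i _]; rewrite ?herm0l ?hermDl ?hermZl.
Qed.

Lemma herm_mulIr u v : w u (mulI v) = - w (mulI u) v.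
Proof.
have e := herm_compat hw (mulI u) v; rewrite mulI2K in e.
by rewrite -e -[- u]scaleN1r hermZl mulN1r opprK.
Qed.

Lemma herm_eq0 u : w u (mulI u) = 0 -> u = 0.
Proof. by move=> h; apply/eqP/negPn/negP => /(herm_pos hw); rewrite h ltxx. Qed.

Lemma herm_nondeg u : (forall v, w u v = 0) -> u = 0.
Proof. by move=> h; apply: herm_eq0; exact: h. Qed.

Lemma herm_repr (l : E -> R) : linear (l : E -> R^o) -> exists V, forall u, w V u = l u.
Proof.
move=> ll.
have ex (x : 'rV[R]_n) : (\sum_j x 0 j *: ((delta_mx 0 j, 0) : E)) = (x, 0).
  rewrite [in RHS](row_sum_delta x); elim/big_rec2 : _ => // i y1 y2 _ ->.
  by congr pair => /=; rewrite scaler0 addr0.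
have ey (x : 'rV[R]_n) : (\sum_j x 0 j *: ((0, delta_mx 0 j) : E)) = (0, x).
  rewrite [in RHS](row_sum_delta x); elim/big_rec2 : _ => // i y1 y2 _ ->.
  by congr pair => /=; rewrite scaler0 addr0.
have eu (u : E) : u = \sum_j u.1 0 j *: ((delta_mx 0 j, 0) : E) + \sum_j u.2 0 j *: ((0, delta_mx 0 j) : E).
  by rewrite ex ey; case: u => a b; congr pair => /=; rewrite ?addr0 ?add0r.
pose Phi (V : E) : E := (\row_j w V (delta_mx 0 j, 0), \row_j w V (0, delta_mx 0 j)).
have lPhi : linear Phi.
  by move=> c u v; congr pair; apply/rowP => j; rewrite !mxE (herm_lin hw).
pose F : {linear E -> E} := HB.pack Phi (GRing.isLinear.Build R E E *:%R Phi lPhi).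
have [|V eV] := @linear_inj_surj R E F _ (\row_j l (delta_mx 0 j, 0), \row_j l (0, delta_mx 0 j)).
  move=> u [/rowP h1 /rowP h2]; apply: herm_nondeg => v; rewrite (eu v) hermDr !herm_sumr.
  rewrite !big1 ?addr0 // => j _.
    by have := h2 j; rewrite !mxE => ->; rewrite mulr0.
  by have := h1 j; rewrite !mxE => ->; rewrite mulr0.
case: eV => /rowP h1 /rowP h2; exists V => u; rewrite (eu u) hermDr !herm_sumr.
have [G eG] := linP (ll : linear (l : E -> R)).
rewrite -eG linearD !linear_sum; congr (_ + _); apply: eq_bigr => j _; rewrite linearZ; congr (_ * _).
  by have := h1 j; rewrite !mxE eG.
by have := h2 j; rewrite !mxE eG.
Qed.

Section Isotropic.
Context {N : nat} (Z : 'I_N -> E).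
Hypothesis iso : forall i j, w (Z i) (Z j) = 0.

(** If [A + mulI B = 0] with [A] and [B] in the isotropic real span, then
    [w B (mulI B) = - w B A = 0], and positivity gives [B = 0]. *)
Lemma isotropic_complex_free :
  (forall c : 'I_N -> R, \sum_i c i *: Z i = 0 -> forall i, c i = 0) ->
  forall a b : 'I_N -> R, \sum_i a i *: Z i + mulI (\sum_i b i *: Z i) = 0 ->
  (forall i, a i = 0) /\ (forall i, b i = 0).
Proof.
move=> free a b h; set B := \sum_i b i *: Z i in h.
have B0 : B = 0.
  apply: herm_eq0; rewrite [mulI B](_ : _ = - \sum_i a i *: Z i); last first.
    by apply/eqP; rewrite -subr_eq0 opprK addrC h.
  rewrite -scaleN1r hermZr herm_sumr big1 ?mulr0 // => i _.
  by rewrite herm_suml big1 ?mulr0 // => j _; rewrite iso mulr0.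
have mI0 : mulI (0 : E) = 0 by rewrite /mulI /= oppr0.
by split; apply: free => //; move: h; rewrite B0 mI0 addr0.
Qed.

Lemma isotropic_row_free :
  (forall c : 'I_N -> R, \sum_i c i *: Z i = 0 -> forall i, c i = 0) ->
  row_free (\matrix_i toC (Z i)).
Proof.
move=> free; rewrite -kermx_eq0; apply/rowV0P => c; rewrite sub_kermx => /eqP h.
have : \sum_i complex.Re (c 0 i) *: Z i + mulI (\sum_i complex.Im (c 0 i) *: Z i) = 0.
  apply: toC_inj; rewrite toC_comb toC0 -[RHS]h mulmx_sum_row; apply: eq_bigr => i _.
  by rewrite rowK; case: (c 0 i).
move=> /(isotropic_complex_free free)[h1 h2]; apply/rowP => i; rewrite mxE.
by move: (h1 i) (h2 i); case: (c 0 i) => /= x y -> ->.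
Qed.

End Isotropic.

(** A Lagrangian subspace is its own orthogonal. By dimension [u = S a + mulI (S b)]; orthogonality
    of [u] to [S b] leaves [w (S b) (mulI (S b)) = 0], so [S b] vanishes. *)
Lemma lagrangian_span (Z : 'I_n -> E) : (forall i j, w (Z i) (Z j) = 0) ->
  (forall c : 'I_n -> R, \sum_i c i *: Z i = 0 -> forall i, c i = 0) ->
  forall u, (forall i, w (Z i) u = 0) -> exists c : 'I_n -> R, u = \sum_i c i *: Z i.
Proof.
move=> iso free u hu.
pose S (x : 'rV[R]_n) : E := \sum_i x 0 i *: Z i.
have lS : linear S.
  move=> c x y; rewrite /S scaler_sumr -big_split; apply: eq_bigr => i _.
  by rewrite !mxE scalerDl scalerA.
pose Psi (ab : E) : E := S ab.1 + mulI (S ab.2).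
have lPsi : linear Psi.
  move=> c x y; rewrite /Psi /= !lS mulI_linear scalerDr.
  by rewrite addrACA.
pose F : {linear E -> E} := HB.pack Psi (GRing.isLinear.Build R E E *:%R Psi lPsi).
have [|[a b] eab] := @linear_inj_surj R E F _ u.
  move=> [a b] h; have [h1 h2] := isotropic_complex_free iso free h.
  by congr pair; apply/rowP => i; rewrite mxE; [exact: h1|exact: h2].
have wSS x y : w (S x) (S y) = 0.
  rewrite herm_sumr big1 // => i _; rewrite herm_suml big1 ?mulr0 // => j _.
  by rewrite iso mulr0.
have Sb0 : S b = 0.
  apply: herm_eq0.
  have : w (S b) u = 0 by rewrite herm_suml big1 // => i _; rewrite hu mulr0.
  by rewrite -eab /= /Psi /= hermDr wSS add0r.
exists (fun i => a 0 i); rewrite -eab /= /Psi /= Sb0.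
by rewrite /mulI /= oppr0 addr0.
Qed.

End Hermitian.

Section Phase.
Context {R : realType}.

Lemma det_imaginary m (A : 'M[R[i]]_m) : (forall i j, complex.Re (A i j) = 0) ->
  exists r : R, \det A = Complex 0 1 ^+ m * rC r.
Proof.
move=> h; exists (\det (\matrix_(i, j) complex.Im (A i j))).
rewrite -det_map_mx -detZ; congr (\det _); apply/matrixP => i j; rewrite !mxE.
by rewrite [LHS]CxE h [rC 0]rmorph0 add0r.
Qed.

Lemma phase m : exists theta : R, forall r : R,
  complex.Im (Complex (cos theta) (sin theta) * (Complex 0 1 ^+ m * rC r)) = 0.
Proof.
have [s [e|e]] : exists s : R, Complex 0 1 ^+ m = rC s \/ Complex 0 1 ^+ m = Complex 0 1 * rC s.
- elim: m => [|m [s [e|e]]]; first by exists 1; left.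
    by exists s; right; rewrite exprS e.
  by exists (- s); left; rewrite exprS e /rC !CxM; congr Complex; ring.
- by exists 0 => r; rewrite cos0 sin0 e /rC !CxM /=; ring.
- by exists (pi / 2) => r; rewrite cos_pihalf sin_pihalf e /rC !CxM /=; ring.
Qed.

End Phase.

(* The maps [v |-> V] dual to each other under [wY] and [wX] descend to an
   endomorphism of the base which commutes with [mulI]; it is a homothety as soon
   as it is one on a totally real subspace. *)
Lemma conformal_lift (R : realType) n m (wX : Cn R n -> Cn R n -> R) (wY : Cn R m -> Cn R m -> R)
    (dF : Cn R n -> Cn R m) (c : R) (t : 'rV[R]_m -> Cn R m) :
  hermitian wX -> hermitian wY -> linear dF ->
  (forall u, dF (mulI u) = mulI (dF u)) -> (forall v, exists u, dF u = v) ->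
  (forall v, exists a b, v = t a + mulI (t b)) ->
  (forall a V W, (forall u, wX V u = wY (t a) (dF u)) ->
     (forall u, dF u = 0 -> wX W u = 0) -> dF W = t a -> V = c *: W) ->
  forall v V, (forall u, wX V u = wY v (dF u)) -> dF V = c *: v.
Proof.
move=> hX hY ldF JdF sdF span hc.
have [dL edL] := linP ldF.
have ex v : exists V, forall u, wX V u = wY v (dF u).
  apply: (herm_repr hX) => a u1 u2; rewrite -edL linearP (hermDr hY) (hermZr hY).
  by [].
pose G v := sval (cid (ex v)).
have GE v u : wX (G v) u = wY v (dF u) by rewrite /G; case: cid.
have Gu v V : (forall u, wX V u = wY v (dF u)) -> V = G v.
  move=> h; apply/eqP; rewrite -subr_eq0; apply/eqP; apply: (herm_nondeg hX) => u.
  by rewrite (hermDl hX) -scaleN1r (hermZl hX) h GE mulN1r subrr.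
pose Phi v := dF (G v).
have lPhi : linear Phi.
  move=> a u v; rewrite /Phi -ldF; congr dF; apply/esym; apply: Gu => z.
  by rewrite (herm_lin hX) !GE (herm_lin hY).
have JPhi v : Phi (mulI v) = mulI (Phi v).
  rewrite /Phi -JdF; congr dF; apply/esym; apply: Gu => z.
  by apply: oppr_inj; rewrite -(herm_mulIr hX) GE JdF (herm_mulIr hY).
(* If [Phi v = 0], then [wX (G v) (mulI (G v)) = wY v (mulI (Phi v)) = 0], so positivity on [X]
   kills [G v], and nondegeneracy on [Y] kills [v]. *)
have kPhi v : Phi v = 0 -> v = 0.
  move=> Pv0; have V0 : G v = 0.
    apply: (herm_eq0 hX); rewrite GE JdF -/(Phi v) Pv0.
    by rewrite (_ : mulI 0 = 0) ?(herm0r hY) // /mulI /= oppr0.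
  apply: (herm_nondeg hY) => z; have [u <-] := sdF z.
  by rewrite -GE V0 (herm0l hX).
pose L : {linear Cn R m -> Cn R m} := HB.pack Phi (GRing.isLinear.Build R _ _ *:%R Phi lPhi).
have PhiE v : Phi v = c *: v.
  have Pt a : Phi (t a) = c *: t a.
    (* The horizontal lift of [t a] that [hc] asks for is itself some [G v']: every [G v'] is
       orthogonal to the kernel of [dF], and [Phi] is onto. *)
    have [v' ev'] := linear_inj_surj (L := L) kPhi (t a).
    rewrite /Phi (hc a (G (t a)) (G v')) //.
      by have /linP[M eM] := ldF; rewrite -eM linearZ /= eM; congr (_ *: _).
    by move=> u u0; rewrite GE u0 (herm0r hY).
  have [a [b ->]] := span v.
  rewrite -[t a]scale1r lPhi JPhi !Pt scalerDr !scale1r; congr (_ + _).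
  have [M eM] := linP (@mulI_linear R m); rewrite -eM linearZ //.
by move=> v V /Gu ->; exact: PhiE.
Qed.

(** * Holomorphic functions and toric manifolds *)

Section Holomorphic.
Context {R : realType} {n : nat} {X : complexManifold R n}.

Lemma kahler_hermitian (w : X -> Cn R n -> Cn R n -> R) p : is_kahler w -> hermitian (w p).
Proof.
move=> kw; split; [exact: kahler_linear|exact: kahler_anti|exact: kahler_compat|exact: kahler_pos].
Qed.

Lemma mdiff_continuous (W : normedModType R) (g : X -> W) x :
  mdiff g x -> {for x, continuous g}.
Proof.
move=> /differentiable_continuous cg.
have h : {for x, continuous ((g \o chartV x) \o chart x)}.
  by apply: continuous_comp; [exact: (chart_continuous (dom_self x))|exact: cg].
have e : {near x, (g \o chartV x) \o chart x =1 g}.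
  by apply: filterS (near_dom (dom_self x)) => y dy /=; rewrite chartK.
have : continuous_at x ((g \o chartV x) \o chart x) := h.
rewrite /continuous_at /= chartV_self => c.
suff : continuous_at x g by [].
by apply: cvg_trans c; apply: near_eq_cvg; apply: filterS e => y /esym.
Qed.

Lemma holo_smooth (U : set X) (s : X -> R[i]) : holo_on U s -> smooth_on U (@cpair R \o s).
Proof. by move=> hs p; have [] := hs p. Qed.

Lemma holo_mdiff (U : set X) (s : X -> R[i]) x : holo_on U s -> U x -> mdiff (@cpair R \o s) x.
Proof. by move=> /holo_smooth; exact: smooth_mdiff. Qed.

Lemma cpair_eq0 (z : R[i]) : cpair z = 0 -> z = 0.
Proof. by case: z => a b [-> ->]. Qed.

Lemma holo_near_neq0 (U : set X) (s : X -> R[i]) x : holo_on U s -> U x -> s x != 0 ->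
  \forall y \near x, s y != 0.
Proof.
move=> hs Ux sx; have /cvgrPdist_lt/(_ `|cpair (s x)|) := mdiff_continuous (holo_mdiff hs Ux).
rewrite normr_gt0 => h; have {h}/h : cpair (s x) != 0.
  by apply: contraNneq sx => /cpair_eq0 ->.
apply: filterS => y /=; apply: contraTneq => ->.
by rewrite (_ : cpair 0 = 0) // subr0 ltxx.
Qed.

Lemma open_nonzero (U : set X) (s : X -> R[i]) : open U -> holo_on U s ->
  open [set x | U x /\ s x != 0].
Proof.
move=> oU hs; rewrite openE => x [Ux sx].
by apply: filterI; [exact: open_nbhs_nbhs|exact: holo_near_neq0 hs Ux sx].
Qed.

Lemma analytic_closed (A : set X) : analytic_set A -> closed A.
Proof.
move=> hA x clx; have [U [N [s [oU Ux hs UA]]]] := hA x.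
apply/(UA x Ux) => j; apply/eqP/negPn/negP => sx.
have [y [Ay [Uy /eqP]]] := clx _ (filterI (open_nbhs_nbhs (conj oU Ux)) (holo_near_neq0 (hs j) Ux sx)).
by apply; exact: (UA y Uy).1.
Qed.

Lemma divisor_closed (D : set X) (h : X -> R[i]) : volume_form_simple_poles D h -> closed D.
Proof.
move=> hD x clx; have [U [s [g [oU Ux _ [hs UD _] _]]]] := hD x.
apply/(UD x Ux)/eqP/negPn/negP => sx.
have [y [Dy [Uy /eqP]]] := clx _ (filterI (open_nbhs_nbhs (conj oU Ux)) (holo_near_neq0 hs Ux sx)).
by apply; exact: (UD y Uy).1.
Qed.

Lemma volume_form_neq0 (D : set X) (h : X -> R[i]) x :
  volume_form_simple_poles D h -> ~ D x -> h x != 0.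
Proof.
move=> hD nDx; have [U [s [g [oU Ux _ _ [_ g0 sg]]]]] := hD x.
by have := g0 x Ux; rewrite -sg //; apply: contraNneq => h0; rewrite /nform_coef /nform h0 mul0r mulr0.
Qed.

Lemma cder_linear (s : X -> R[i]) x : mdiff (@cpair R \o s) x ->
  forall a u v, cder s x (a *: u + v) = rC a * cder s x u + cder s x v.
Proof.
move=> ds a u v; rewrite /cder (der_linear ds) /rC CxM CxD /=.
by rewrite !mul0r subr0 addr0.
Qed.

Lemma cder_mulI (U : set X) (s : X -> R[i]) x u : holo_on U s -> U x ->
  cder s x (mulI u) = Complex 0 1 * cder s x u.
Proof.
move=> hs Ux; have [_ +] := hs x.
move=> /(_ (chart x x) u) h; rewrite /cder /der.
rewrite (_ : 'D_(mulI u) ((@cpair R \o s) \o chartV x) (chart x x) = mulIc ('D_u ((@cpair R \o s) \o chartV x) (chart x x))).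
  by rewrite CxM /= !mul0r !mul1r sub0r add0r.
by apply: h; exists x => //; split => //; exact: dom_self.
Qed.

Lemma cmodE (z : R[i]) : cmod z = Num.sqrt ((cpair z).1 ^+ 2 + (cpair z).2 ^+ 2).
Proof. by case: z. Qed.

Lemma cmod_gt0 (z : R[i]) : z != 0 -> 0 < (cpair z).1 ^+ 2 + (cpair z).2 ^+ 2.
Proof.
move=> z0; rewrite lt_neqAle addr_ge0 ?sqr_ge0 // andbT eq_sym.
by rewrite paddr_eq0 ?sqr_ge0 // !sqrf_eq0; case: z z0 => a b; rewrite eq_complex.
Qed.

Lemma cmod_smooth (U : set X) (s : X -> R[i]) : open U -> holo_on U s ->
  (forall x, U x -> s x != 0) -> smooth_on U (fun x => cmod (s x)).
Proof.
move=> oU hs s0 p r; have sm : Ck r (chart p @` (dom p `&` U)) (@cpair R \o s \o chartV p).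
  by have [+ _] := hs p; exact.
have oI := @open_img _ _ _ p _ oU.
have fstc : continuous (@fst R R) by move=> z; exact: cvg_fst.
have sndc : continuous (@snd R R) by move=> z; exact: cvg_snd.
have C1 := Ck_linear oI fstc (fun _ _ _ => erefl) sm.
have C2 := Ck_linear oI sndc (fun _ _ _ => erefl) sm.
have C := Ck_add oI (Ck_mul oI C1 C1) (Ck_mul oI C2 C2).
have := Ck_comp_scalar findimR oI _ C (Ck_sqrt r).
have pos z : (chart p @` (dom p `&` U)) z -> [set x : R | 0 < x] ((fst \o (@cpair R \o s \o chartV p)) z * (fst \o (@cpair R \o s \o chartV p)) z + (snd \o (@cpair R \o s \o chartV p)) z * (snd \o (@cpair R \o s \o chartV p)) z).
  move=> [x [dx Ux] <-] /=; rewrite chartK // -!expr2; apply: cmod_gt0; exact: s0.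
move=> /(_ pos); apply: Ck_congr => // z _ /=.
by rewrite cmodE !expr2.
Qed.

(** This is the differential of the real part of [log s], obtained from the square of the modulus,
    so that no branch of the logarithm is chosen. *)
Lemma der_cmod (U : set X) (s : X -> R[i]) x u : open U -> holo_on U s -> U x -> s x != 0 ->
  der (fun y => cmod (s y)) x u = cmod (s x) * complex.Re (dlog s x u).
Proof.
move=> oU hs Ux sx; have dx := dom_self x.
set g := (@cpair R \o s) \o chartV x.
have dg : differentiable g (chart x x) by exact: holo_mdiff hs Ux.
have ex : chartV x (chart x x) = x by exact: chartV_self.
pose q (z : Cn R n) : R := (g z).1 * (g z).1 + (g z).2 * (g z).2.
have d1 : differentiable (fun z => (g z).1) (chart x x).
  apply: (differentiable_comp dg (g := fst)); apply: differentiable_linear => //.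
  by move=> z; exact: cvg_fst.
have d2 : differentiable (fun z => (g z).2) (chart x x).
  apply: (differentiable_comp dg (g := snd)); apply: differentiable_linear => //.
  by move=> z; exact: cvg_snd.
have D1 : 'D_u (fun z => (g z).1) (chart x x) = ('D_u g (chart x x)).1.
  rewrite (derive_comp u dg (g := fst)); last first.
    by apply: differentiable_linear => // z; exact: cvg_fst.
  by rewrite derive_linear // => z; exact: cvg_fst.
have D2 : 'D_u (fun z => (g z).2) (chart x x) = ('D_u g (chart x x)).2.
  rewrite (derive_comp u dg (g := snd)); last first.
    by apply: differentiable_linear => // z; exact: cvg_snd.
  by rewrite derive_linear // => z; exact: cvg_snd.
have dq : differentiable q (chart x x) by apply: differentiableD; exact: differentiableM.
have q0 : 0 < q (chart x x).
  by rewrite /q /g /= ex -!expr2; exact: cmod_gt0.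
have [ds Ds] := is_derive1_sqrt q0.
have := derive_comp u dq ((derivable1_diffP _ _).1 ds).
have -> : Num.sqrt \o q = (fun y => cmod (s y)) \o chartV x.
  by apply/funext => z; rewrite /= cmodE !expr2.
rewrite -/(der _ x u) => ->.
rewrite -[X in 'D_X _ _]mulr1 deriveZl; last exact/derivable1_diffP.
rewrite Ds [X in X *: _](_ : _ = 2 * ((g (chart x x)).1 * ('D_u g (chart x x)).1 + (g (chart x x)).2 * ('D_u g (chart x x)).2)); last first.
  rewrite deriveD; [|by apply: diff_derivable; exact: differentiableM..].
  rewrite !deriveM; [|exact: diff_derivable..].
  rewrite D1 D2 /GRing.scale /=; ring.
have e1 : (g (chart x x)).1 = complex.Re (s x) by rewrite /g /= ex; case: (s x).
have e2 : (g (chart x x)).2 = complex.Im (s x) by rewrite /g /= ex; case: (s x).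
have -> : cmod (s x) = Num.sqrt (q (chart x x)) by rewrite /q /g /= ex cmodE !expr2.
have -> : dlog s x u = Complex ('D_u g (chart x x)).1 ('D_u g (chart x x)).2 / s x by [].
set d := 'D_u g (chart x x); set r := Num.sqrt _.
have r0 : r != 0 by rewrite lt0r_neq0 // sqrtr_gt0.
have r2 : complex.Re (s x) ^+ 2 + complex.Im (s x) ^+ 2 = r ^+ 2.
  by rewrite sqr_sqrtr ?ltW // /q e1 e2 !expr2.
rewrite e1 e2; move: r2; case: (s x) => a b /= r2.
rewrite r2 [_ *: _]mulrC mulrN opprK; field; exact: r0.
Qed.

End Holomorphic.

Section SmoothMaps.
Context {R : realType} {n m : nat} {X : complexManifold R n} {Y : complexManifold R m}.

Lemma holo_preimage_open (U : set X) (F : X -> Y) (A : set Y) : open U -> holo_map U F ->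
  open A -> open (U `&` F @^-1` A).
Proof.
move=> oU [cF _] oA; rewrite openE => x [Ux Ax].
by apply: filterI; [exact: open_nbhs_nbhs|apply: (cF x Ux); exact: open_nbhs_nbhs].
Qed.

Lemma smooth_comp_map (W : normedModType R) (U : set X) (V : set Y) (F : X -> Y) (g : Y -> W) :
  findim W -> open U -> open V -> holo_map U F -> smooth_on V g ->
  smooth_on (U `&` F @^-1` V) (g \o F).
Proof.
move=> fW oU oV hF sg p r; apply: Ck_local => _ [x [dx [Ux Vx]] <-].
set q := F x; pose A := dom q `&` V.
have oA : open A by apply: openI => //; exact: dom_open.
exists (chart p @` (dom p `&` (U `&` F @^-1` A))).
  by exists x => //; split => //; split => //; split => //; exact: dom_self.
have oI := @open_img _ _ _ p _ (holo_preimage_open oU hF oA).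
have C1 : Ck r (chart p @` (dom p `&` (U `&` F @^-1` A))) (chart q \o F \o chartV p).
  have [_ /(_ p q) [/(_ r) + _]] := hF; apply: Ck_mono => _ [y [dy [Uy [dqy Vy]]] <-].
  by exists y.
have C2 : Ck r (chart q @` A) (g \o chartV q) by exact: sg.
have := Ck_comp (@findim_Cn R m) fW oI (@open_img _ _ _ q _ oV) _ C1 C2.
have h z : (chart p @` (dom p `&` (U `&` F @^-1` A))) z -> (chart q @` A) ((chart q \o F \o chartV p) z).
  by move=> [y [dy [Uy Ay]] <-] /=; rewrite chartK //; exists (F y).
move=> /(_ h); apply: Ck_congr => // _ [y [dy [Uy [dqy Vy]]] <-] /=.
by rewrite !chartK.
Qed.

End SmoothMaps.

Section Toric.
Context {R : realType}.

Lemma torus_smooth_action n k (X : complexManifold R n) (act : 'rV[R]_k -> X -> X) :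
  torus_action act -> smooth_action act.
Proof. by case. Qed.

Context {m : nat} (Y : toricKahlerManifold R m).

Lemma toric_smooth_action : smooth_action (@tk_act R m Y).
Proof.
split; [exact: tk_act0|exact: tk_actD|exact: tk_continuous|].
by move=> p q; have [] := tk_holo p q.
Qed.

Let V (u : Cn R m) (y : Y) := velocity (act := @tk_act R m Y) u y.

Lemma toric_velocity_mulI u y : V (mulI u) y = mulI (V u y).
Proof.
have dy := dom_self y; have dy0 : dom y (tk_act 0 y) by rewrite tk_act0.
rewrite /V /velocity !(orbit_derive toric_smooth_action _ dy dy0).
have [_ /(_ (0, chart y y) (u, 0)) <-] := tk_holo y y; last by exists y.
by congr ('D_ _ _ _); rewrite /mulI2 /mulI /= oppr0.
Qed.

(** A zero velocity makes the whole line [t *: u] fix [y]. The group being commutative, the line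
    also fixes [tk_base], so by [tk_free] it lies in the discrete lattice of periods. *)
Lemma toric_velocity_inj u y : open_orbit y -> V u y = 0 -> u = 0.
Proof.
move=> [u0 _ <-] v0; have fx := velocity0_fix toric_smooth_action v0.
have hz (t : R) : exists z : 'I_m -> int, t *: u = (0, \row_j (2 * pi * (z j)%:~R)).
  apply: (@tk_free R m Y); have := fx t.
  rewrite -tk_actD addrC tk_actD => /(congr1 (tk_act (- u0))).
  by rewrite -!(tk_actD (- u0)) addNr !tk_act0.
have [z1] := hz 1; rewrite scale1r => e1.
have u10 : u.1 = 0 by rewrite e1.
suff u20 : u.2 = 0 by case: (u) u10 u20 => a b /= -> ->.
apply/rowP => j; rewrite mxE; apply/eqP/negPn/negP => uj0.
(* At this time the [j]-th coordinate equals [pi], half a period, which would give [1 = 2 * z j]. *)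
have [z ez] := hz (pi / u.2 0 j).
have := congr1 (fun w : Cn R m => w.2 0 j) ez; rewrite !mxE /= divfK //.
move=> e; have : 1%:~R = (2 * z j)%:~R :> R.
  apply: (mulfI (lt0r_neq0 (pi_gt0 R))); rewrite mulr1 [LHS]e intrM; ring.
move=> /eqP; rewrite eqr_int => /eqP/(congr1 absz); rewrite abszM => /(congr1 odd).
by rewrite oddM.
Qed.

Lemma toric_span y v : open_orbit y -> exists a b : 'rV[R]_m,
  v = velocity (act := fun t => @tk_act R m Y (0, t)) a y
      + mulI (velocity (act := fun t => @tk_act R m Y (0, t)) b y).
Proof.
move=> oy.
have VE (a : 'rV[R]_m) : velocity (act := fun t => @tk_act R m Y (0, t)) a y = V (0, a) y.
  have ll : linear (fun t : 'rV[R]_m => (0, t) : Cn R m).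
    by move=> c a1 a2; congr pair; rewrite /= scaler0 addr0.
  have cl := findim_linear_continuous (@findim_rV R m) ll.
  have dy := dom_self y; have dy0 : dom y (tk_act 0 y) by rewrite tk_act0.
  have d1 := differentiable_linear 0 cl ll.
  have d2 := orbit_diff toric_smooth_action dy dy0.
  have := derive_comp a d1 d2; rewrite (derive_linear _ _ cl ll) => h; exact: h.
have lV : linear (V^~ y) by exact: velocity_linear toric_smooth_action y.
pose F : {linear Cn R m -> Cn R m} := HB.pack (V^~ y) (GRing.isLinear.Build R _ _ *:%R (V^~ y) lV).
have [|[a b] eab] := linear_inj_surj (L := F) _ v.
  by move=> u; exact: toric_velocity_inj.
(* The sign comes from [(a, 0) = mulI (0, - a)]. *)
exists b, (- a); rewrite !VE -toric_velocity_mulI -eab /= /mulI /= opprK.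
have -> : (a, b) = (0, b) + (a, 0) :> Cn R m by congr pair; rewrite ?addr0 ?add0r.
by have := lV 1 (0, b) (a, 0); rewrite !scale1r.
Qed.

End Toric.

(** * Submersions *)

Section Submersion.
Context {R : realType}.

Lemma big_continuous (T : topologicalType) (I : Type) (r : seq I) (op : R -> R -> R) (idx : R)
    (F : I -> T -> R) (x : T) :
  (forall f g : T -> R, {for x, continuous f} -> {for x, continuous g} ->
     {for x, continuous (fun z => op (f z) (g z))}) ->
  (forall i, {for x, continuous (F i)}) ->
  {for x, continuous (fun z => \big[op/idx]_(i <- r) F i z)}.
Proof.
move=> hop hF; elim: r => [|i r IH].
  rewrite (_ : (fun z => _) = fun=> idx); first exact: cst_continuous.
  by apply/funext => z; rewrite big_nil.
rewrite (_ : (fun z => _) = fun z => op (F i z) (\big[op/idx]_(i <- r) F i z)).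
  by apply: hop.
by apply/funext => z; rewrite big_cons.
Qed.

Lemma det_continuous (T : topologicalType) N (A : T -> 'M[R]_N) (x : T) :
  (forall i j, {for x, continuous (fun z => A z i j)}) -> {for x, continuous (fun z => \det (A z))}.
Proof.
move=> hA; apply: big_continuous => [f g cf cg|s]; first exact: continuousD.
apply: continuousM; first exact: cst_continuous.
by apply: big_continuous => // f g cf cg; exact: continuousM.
Qed.

Context {n : nat} {X : complexManifold R n}.

Lemma der_linear_comp (W Z : normedModType R) (l : W -> Z) (g : X -> W) x u :
  continuous l -> linear l -> mdiff g x -> der (l \o g) x u = l (der g x u).
Proof.
move=> cl ll dg; have dl := differentiable_linear ((g \o chartV x) (chart x x)) cl ll.
by have := derive_comp u dg dl; rewrite (derive_linear _ _ cl ll).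
Qed.

Lemma der_coord N (g : X -> 'rV[R]_N) x u i : mdiff g x ->
  der (fun y => g y 0 i) x u = der g x u 0 i.
Proof.
move=> dg; apply: (@der_linear_comp _ R (fun v : 'rV[R]_N => v 0 i)) dg.
  exact: coord_continuous.
by move=> c a b; rewrite !mxE.
Qed.

(** Lifts [e i] of the standard basis at [x] are kept fixed in the chart of [x]; the determinant of
    their images is 1 at [x] and nonzero nearby by continuity. *)
Lemma submersion_near N (g : X -> 'rV[R]_N) (U : set X) x : open U -> smooth_on U g -> U x ->
  (forall v, exists u, der g x u = v) ->
  \forall y \near x, forall v, exists u, der g y u = v.
Proof.
move=> oU sg Ux hx; have dx := dom_self x.
pose e i := sval (cid (hx (delta_mx 0 i))).
have eE i : der g x (e i) = delta_mx 0 i by rewrite /e; case: cid.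
pose A z := \matrix_(i, j) ('D_(e i) (g \o chartV x) z) 0 j.
have cA i j : {for chart x x, continuous (fun z => A z i j)}.
  rewrite (_ : (fun z => _) = fun z => ('D_(e i) (g \o chartV x) z) 0 j); last first.
    by apply/funext => z; rewrite mxE.
  apply: (@continuous_comp _ _ _ ('D_(e i) (g \o chartV x)) (fun v : 'rV[R]_N => v 0 j)).
    by have [_ /(_ (e i)) +] := sg x 1%N; apply; exists x.
  exact: coord_continuous.
have A1 : A (chart x x) = 1%:M.
  by apply/matrixP => i j; rewrite !mxE -/(der g x (e i)) eE mxE eqxx eq_sym.
have : \forall z \near chart x x, \det (A z) != 0.
  have := det_continuous cA; rewrite /prop_for /continuous_at A1 det1 => /cvgrPdist_lt/(_ 1 ltr01).
  by apply: filterS => z; apply: contraTneq => ->; rewrite subr0 normr1 ltxx.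
move=> /(near_chart dx) hdet.
have := open_nbhs_nbhs (conj oU Ux).
move: hdet (near_dom dx); apply: filterS3 => y dA dy Uy v.
have dgy : mdiff g y by exact: smooth_mdiff sg Uy.
have uA : A (chart x y) \in unitmx by rewrite unitmxE unitfE.
exists (tvec x y (\sum_i (v *m invmx (A (chart x y))) 0 i *: e i)).
rewrite -(der_chart _ dy dgy) derive_sum_dir; last exact: mdiff_chart.
rewrite -[RHS](mulmxKV uA) [RHS]mulmx_sum_row; apply: eq_bigr => i _; congr (_ *: _).
by apply/rowP => j; rewrite !mxE.
Qed.

Lemma nonneg_der0 (g : X -> R) x u : mdiff g x -> (forall y, 0 <= g y) -> g x = 0 -> der g x u = 0.
Proof.
move=> dg g0 gx; set G := g \o chartV x; set z := chart x x.
have G0 y : 0 <= G y by exact: g0.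
have Gz : G z = 0 by rewrite /G /z /= chartV_self.
have D0 v : 0 <= 'd G z v.
  rewrite leNgt; apply/negP => Dv.
  have v1 : 0 < `|v| + 1 by rewrite ltr_pwDr.
  (* This error rate satisfies [e * |v| < - 'd G z v], so the remainder cannot compensate the
     descent along [t *: v], and [G] would become negative. *)
  pose e := - 'd G z v / (`|v| + 1).
  have e0 : 0 < e by rewrite divr_gt0 // oppr_gt0.
  have /eqaddoP/(_ e e0) := diff_locally dg.
  move=> /nbhs_ballP[d /= d0 hd].
  pose t := d / 2 / (`|v| + 1).
  have t0 : 0 < t by rewrite !divr_gt0.
  have tv : `|t *: v| = t * `|v| by rewrite normrZ gtr0_norm.
  have {}hd h : `|h| < d -> `|G (h + z) - (G z + 'd G z h)| <= e * `|h|.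
    by move=> hh; apply: hd; rewrite -ball_normE /= sub0r normrN.
  have tvd : `|t *: v| < d.
    rewrite tv (@lt_le_trans _ _ (t * (`|v| + 1))) ?ltr_pM2l ?ltrDl // /t divfK ?gt_eqF //.
    by move: d0; clear; lra.
  have := hd _ tvd; rewrite Gz add0r linearZ tv => h.
  have : - (t * 'd G z v) <= e * (t * `|v|).
    apply: le_trans (le_trans (ler_norm _) h); rewrite -[leLHS]add0r lerD2r; exact: G0.
  rewrite -mulrN mulrCA ler_pM2l // /e.
  rewrite mulrAC ler_pdivlMr // => {}h.
  have := Dv; rewrite -oppr_gt0 => Dv'.
  move: h; rewrite ler_pM2l // => h; move: h; set a := `|v|; lra.
rewrite /der deriveE //; apply/eqP; rewrite eq_le D0 andbT.
by have := D0 (- u); rewrite linearN oppr_ge0.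
Qed.

Lemma complex_span m (u : 'I_m -> Cn R m) : \det (\matrix_(i, j) toC (u i) 0 j) != 0 ->
  forall v, exists a b : 'I_m -> R, v = \sum_i a i *: u i + mulI (\sum_i b i *: u i).
Proof.
set T := \matrix_(i, j) _ => dT v.
have uT : T \in unitmx by rewrite unitmxE unitfE.
pose c := toC v *m invmx T.
exists (fun i => complex.Re (c 0 i)), (fun i => complex.Im (c 0 i)).
apply: toC_inj; rewrite toC_comb -[LHS](mulmxKV uT) -/c mulmx_sum_row.
apply: eq_bigr => i _; rewrite (_ : row i T = toC (u i)); first by case: (c 0 i).
by apply/rowP => j; rewrite !mxE.
Qed.

End Submersion.

(** * The fibration *)

Section SpecialLagrangianFibration.
Context {R : realType} {k m : nat}.
Context {X : kahlerManifold R (k + m)} {Y : toricKahlerManifold R m}.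
Context (P : pseudotoric X Y).
Context {xi : 'M[R]_k} {mu : X -> 'rV[R]_k}.
Context (hxi : generating_basis (ps_act P) xi).
Context (hmu : moment_map (@kform R (k + m) X) (ps_act P) xi mu).
Context {D : set X} {Omega : X -> R[i]}.
Context (hOmega : volume_form_simple_poles D Omega).
Context (hF : forall x, ~ D x -> ~ ps_base P x /\ ~ toric_divisor (ps_map P x)).
Context {f : 'I_m -> Y -> R[i]}.
Context (hf_holo : forall j, holo_on (@open_orbit R m Y) (f j)).
Context (hf_nonzero : forall j (O : set X), open O -> O `&` ~` D !=set0 ->
  exists2 x, (O `&` ~` D) x & f j (ps_map P x) != 0).
Context (hcontract : forall x, ~ D x -> (forall j, f j (ps_map P x) != 0) ->
  forall w : 'I_m -> Cn R (k + m),
    nform Omega x (fun i : 'I_(k + m) =>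
      match fintype.split i with
      | inl a => fundamental_field (ps_act P) (row (rev_ord a) xi) x
      | inr b => w b
      end)
    = \det (\matrix_(i, j) dlog (f j \o ps_map P) x (w i))).
Context (hpoisson : forall i j y, @open_orbit R m Y y ->
  f i y != 0 -> f j y != 0 ->
  poisson_commute_at (fun y => cmod (f i y)) (fun y => cmod (f j y)) y).

Let F := ps_map P.
Let nu j x := cmod (f j (F x)).
Let rho (x : X) : 'rV[R]_(k + m) := row_mx (mu x) (\row_j nu j x).
Let V a x := fundamental_field (ps_act P) (row a xi) x.
Let al j x u := dlog (f j \o F) x u.
Let wX (x : X) := kform x.
Let wY (y : Y) := kform y.

Lemma ps_act_smooth : smooth_action (ps_act P).
Proof. exact/torus_smooth_action/ham_action/ps_hamiltonian. Qed.

Lemma hermX x : hermitian (wX x).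
Proof. exact/kahler_hermitian/kformP. Qed.

Lemma hermY y : hermitian (wY y).
Proof. exact/kahler_hermitian/kformP. Qed.

(** The locus where the contraction formula applies and [rho] is smooth. *)
Let good : set X := [set x | ~ D x /\ forall j, f j (F x) != 0].
Let indep x := forall c : 'I_k -> R, \sum_a c a *: V a x = 0 -> forall a, c a = 0.

Lemma ps_map_holo : holo_map (~` ps_base P) F.
Proof. exact/mero_holo/ps_mero. Qed.

Lemma open_base_compl : open (~` ps_base P).
Proof. by apply: closed_openC; apply: analytic_closed; exact: mero_analytic (ps_mero P). Qed.

Lemma open_divisor_compl : open (~` D).
Proof. exact/closed_openC/(divisor_closed hOmega). Qed.

Lemma notin_base x : ~ D x -> ~ ps_base P x.
Proof. by move=> /hF[]. Qed.

Lemma map_open_orbit x : ~ D x -> open_orbit (F x).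
Proof. by move=> /hF[_ h]; apply: contrapT. Qed.

Lemma ps_map_mdiff x : ~ D x -> mdiff_map F x.
Proof. by move=> /notin_base; exact: holo_map_mdiff ps_map_holo. Qed.

Lemma open_f_nonzero j : open [set y : Y | open_orbit y /\ f j y != 0].
Proof. by apply: open_nonzero => //; exact: tk_orbit_open. Qed.

Lemma open_good : open good.
Proof.
rewrite openE => x [nD fx].
have n1 : nbhs x (~` D) by apply: open_nbhs_nbhs; split => //; exact: open_divisor_compl.
have n2 j : \forall y \near x, f j (F y) != 0.
  have [cF _] := ps_map_mdiff nD.
  have h : nbhs x (F @^-1` [set y : Y | open_orbit y /\ f j y != 0]).
    exact: cF _ (open_nbhs_nbhs (conj (open_f_nonzero j) (conj (map_open_orbit nD) (fx j)))).
  by apply: filterS h => y [].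
have n3 : nbhs x [set y | forall j, f j (F y) != 0].
  exact: (@filter_forall _ _ (fun j => [set y : X | f j (F y) != 0]) (nbhs x) _ n2).
exact: (filterI n1 n3).
Qed.

Lemma cmod_f_smooth j : smooth_on [set y : Y | open_orbit y /\ f j y != 0] (fun y => cmod (f j y)).
Proof.
apply: cmod_smooth => [|p|y []//]; first exact: open_f_nonzero.
have [h1 h2] := hf_holo j p; split.
  move=> r; apply: Ck_mono (h1 r) => _ [y [dy [oy _]] <-]; by exists y.
by move=> _ v [y [dy [oy _]] <-]; apply: h2; exists y.
Qed.

Lemma nu_smooth j : smooth_on good (nu j).
Proof.
have := smooth_comp_map findimR open_base_compl (open_f_nonzero j) ps_map_holo (@cmod_f_smooth j).
move=> h p r; apply: Ck_mono (h p r) => _ [x [dx [nD fx]] <-].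
by exists x => //; split => //; split; [exact: notin_base|split; [exact: map_open_orbit|exact: fx]].
Qed.

Lemma rho_coordl a : (fun x => rho x 0 (lshift m a)) = fun x => mu x 0 a.
Proof. by apply/funext => x; rewrite row_mxEl. Qed.

Lemma rho_coordr j : (fun x => rho x 0 (rshift k j)) = nu j.
Proof. by apply/funext => x; rewrite row_mxEr mxE. Qed.

Lemma rho_smooth : smooth_on good rho.
Proof.
move=> p r.
apply: (Ck_coords (e := fun j => delta_mx 0 j) (l := fun j (u : 'rV[R]_(k + m)) => u 0 j)).
- exact: row_sum_delta.
- by apply: open_img; exact: open_good.
move=> i; rewrite (_ : (fun z => _) = (fun x => rho x 0 i) \o chartV p) //.
case: (split_ordP i) => [a|j] ->.
- rewrite (_ : (fun x => _) = fun x => mu x 0 a); last by apply/funext => x; rewrite row_mxEl.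
  have := moment_smooth hmu p r => /(Ck_mono (U' := chart p @` (dom p `&` good))) h.
  apply: (Ck_linear (f := mu \o chartV p) (l := fun u : 'rV[R]_k => u 0 a)).
  + by apply: open_img; exact: open_good.
  + exact: coord_continuous.
  + by move=> c u v; rewrite !mxE.
  + by apply: h => _ [x [dx _] <-]; exists x.
- rewrite (_ : (fun x => _) = nu j); last by apply/funext => x; rewrite row_mxEr mxE.
  exact: nu_smooth.
Qed.

Lemma al_tmap x j u : ~ D x -> al j x u = dlog (f j) (F x) (tmap F x u).
Proof.
move=> nD; rewrite /al /dlog /cder.
have := der_comp (ps_map_mdiff nD) (holo_mdiff (hf_holo j) (map_open_orbit nD)) u.
by rewrite -[_ \o F]/(@cpair R \o (f j \o F)) => ->.
Qed.

Lemma dlog_linear y j a u v : open_orbit y ->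
  dlog (f j) y (a *: u + v) = rC a * dlog (f j) y u + dlog (f j) y v.
Proof.
move=> oy; rewrite /dlog (cder_linear (holo_mdiff (hf_holo j) oy)) mulrDl.
by rewrite mulrA.
Qed.

Lemma dlog_mulI y j u : open_orbit y -> dlog (f j) y (mulI u) = Complex 0 1 * dlog (f j) y u.
Proof. by move=> oy; rewrite /dlog (cder_mulI u (hf_holo j) oy) mulrA. Qed.

Lemma tmap_mulI x u : ~ D x -> tmap F x (mulI u) = mulI (tmap F x u).
Proof. by move=> /notin_base; exact: holo_map_tmapI ps_map_holo. Qed.

Lemma al_mulI x j u : ~ D x -> al j x (mulI u) = Complex 0 1 * al j x u.
Proof. by move=> nD; rewrite !al_tmap // tmap_mulI // dlog_mulI //; exact: map_open_orbit. Qed.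

Lemma nu_der x j u : good x -> der (nu j) x u = nu j x * complex.Re (al j x u).
Proof.
move=> [nD fx]; have oy := map_open_orbit nD.
have dc : mdiff (fun y => cmod (f j y)) (F x).
  apply: (smooth_mdiff (U := [set y : Y | open_orbit y /\ f j y != 0])) => //.
  exact: cmod_f_smooth.
have := der_comp (ps_map_mdiff nD) dc u.
rewrite (der_cmod _ (tk_orbit_open Y) (hf_holo j) oy (fx j)) -al_tmap //.
Qed.

Lemma mu_der x a u : der (fun y => mu y 0 a) x u = wX x (V a x) u.
Proof. by rewrite /V /wX (moment_eq hmu a x u). Qed.

Lemma rho_mdiff x : good x -> mdiff rho x.
Proof. by move=> gx; exact: smooth_mdiff rho_smooth gx. Qed.

Lemma rho_derl x a u : good x -> der rho x u 0 (lshift m a) = wX x (V a x) u.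
Proof.
move=> gx; rewrite -der_coord; last exact: rho_mdiff.
by rewrite -mu_der rho_coordl.
Qed.

Lemma rho_derr x j u : good x -> der rho x u 0 (rshift k j) = nu j x * complex.Re (al j x u).
Proof.
move=> gx; rewrite -der_coord; last exact: rho_mdiff.
by rewrite -nu_der // rho_coordr.
Qed.

(** The components of [mu] are constant along the orbits, so their derivatives along the generating
    fields vanish. *)
Lemma V_isotropic x a b : wX x (V a x) (V b x) = 0.
Proof.
rewrite -mu_der.
have dmu : mdiff (fun y => mu y 0 a) x.
  have d : mdiff mu x by exact: smooth_mdiff (moment_smooth hmu) _.
  have dl : differentiable (fun v : 'rV[R]_k => v 0 a) ((mu \o chartV x) (chart x x)).
    by apply: differentiable_coord.
  exact: (differentiable_comp d dl).
rewrite -[V b x]/(velocity (act := ps_act P) (row b xi) x) -(der_velocity ps_act_smooth) //.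
rewrite (_ : (fun s => _) = fun=> mu x 0 a) ?derive_cst //.
by apply/funext => s; rewrite (moment_invariant hmu).
Qed.

Lemma V_vertical x a : ~ D x -> tmap F x (V a x) = 0.
Proof.
move=> nD; have [_ dF] := ps_map_mdiff nD.
have := der_velocity ps_act_smooth (row a xi) dF.
rewrite (_ : (fun s => _) = fun=> chart (F x) (F x)); last first.
  by apply/funext => s /=; rewrite /F ps_map_inv //; exact: notin_base.
by rewrite derive_cst => /esym.
Qed.

Lemma al_vertical x j u : ~ D x -> tmap F x u = 0 -> al j x u = 0.
Proof.
move=> nD u0; rewrite al_tmap // u0; have oy := map_open_orbit nD.
have := dlog_linear j 1 0 0 oy; rewrite scale1r addr0 (_ : rC 1 = 1) // mul1r => /eqP.
by rewrite -subr_eq subrr eq_sym => /eqP.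
Qed.

(** In the iterated contraction of [Omega], the field [V_k] is inserted first and occupies the first
    slot. The frames used with [hcontract] therefore list the fields in reverse order. *)
Lemma indep_rev x : indep x ->
  forall c : 'I_k -> R, \sum_a c a *: V (rev_ord a) x = 0 -> forall a, c a = 0.
Proof.
move=> fr c; rewrite (reindex_inj rev_ord_inj) /=.
under eq_bigr do rewrite rev_ordK.
by move=> /fr h a; rewrite -[a]rev_ordK; exact: h.
Qed.

(* Isotropy makes the fields [V a] independent over the complex numbers; completed
   to a complex basis they turn the contraction formula into a nonzero determinant. *)
Lemma indep_det x : good x -> indep x ->
  exists u : 'I_m -> Cn R (k + m), \det (\matrix_(i, j) al j x (u i)) != 0.
Proof.
move=> [nD fx] fr.
have iso a b : wX x (V (rev_ord a) x) (V (rev_ord b) x) = 0 by exact: V_isotropic.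
have := isotropic_row_free (hermX x) iso (indep_rev fr).
move=> /row_free_complete[B dB].
pose u b := ofC (row b B); exists u.
have e := hcontract nD fx u; rewrite [X in _ = X](_ : _ = \det (\matrix_(i, j) al j x (u i))) // in e.
rewrite -e /nform; apply: mulf_neq0; first exact: volume_form_neq0 hOmega nD.
rewrite (_ : \matrix_(i, j) _ = col_mx (\matrix_i toC (V (rev_ord i) x)) B); first exact: dB.
apply/matrixP => i j; rewrite mxE.
case: (split_ordP i) => [a|b] ->; first by rewrite col_mxEu mxE.
by rewrite col_mxEd /u ofCK mxE.
Qed.

(** Since [al] is pulled back by [F], the nonsingular matrix of [indep_det] factors through the
    matrix [A] of the images of the [u i]. So [A] is nonsingular and these images span the tangent
    space of [Y] over the complex numbers. *)
Lemma tmap_surj x : good x -> indep x -> forall v, exists u, tmap F x u = v.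
Proof.
move=> gx fr v; have [nD _] := gx; have oy := map_open_orbit nD.
have [u du] := indep_det gx fr.
have [T eT] := linP (tmap_linear (ps_map_mdiff nD)).
pose A := \matrix_(i < m, j < m) toC (tmap F x (u i)) 0 j.
have dA : \det A != 0.
  move: du; apply: contraNneq => A0.
  rewrite (_ : \matrix_(i, j) _ = A *m \matrix_(l, j) dlog (f j) (F x) (unit_vec R l)).
    by rewrite det_mulmx A0 mul0r.
  apply/matrixP => i j; rewrite !mxE al_tmap // (@complex_linear_expand R m (dlog (f j) (F x))).
  - by apply: eq_bigr => l _; rewrite !mxE.
  - by move=> a w z; exact: dlog_linear.
  - by move=> w; exact: dlog_mulI.
have [a [b ->]] := complex_span dA v.
exists (\sum_i a i *: u i + mulI (\sum_i b i *: u i)).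
rewrite -{1}eT linearD /= eT tmap_mulI // -eT !linear_sum; congr (_ + mulI _).
  by apply: eq_bigr => i _; rewrite linearZ.
by apply: eq_bigr => i _; rewrite linearZ.
Qed.

Lemma good_regular x : good x -> indep x -> regular_point rho x.
Proof.
move=> gx fr; have [nD fx] := gx; split.
  by exists good; split => //; [exact: open_good|exact: rho_smooth].
apply: linear_surj; first exact: findim_Cn.
  by apply: der_linear; exact: rho_mdiff.
move=> c hc.
have {}hc u : \sum_a c (lshift m a) * wX x (V a x) u
    + \sum_j c (rshift k j) * (nu j x * complex.Re (al j x u)) = 0.
  rewrite -[RHS](hc u) big_split_ord /=; congr (_ + _); apply: eq_bigr => i _.
    by rewrite rho_derl.
  by rewrite rho_derr.
pose A := \sum_a c (lshift m a) *: V a x.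
have TA : tmap F x A = 0.
  have [T eT] := linP (tmap_linear (ps_map_mdiff nD)).
  by rewrite -eT linear_sum big1 // => a _; rewrite linearZ /= eT V_vertical // scaler0.
(* The relation is evaluated at [mulI A]: as [A] is vertical and [F] is holomorphic, only
   [wX x A (mulI A)] survives. *)
have A0 : A = 0.
  apply: (herm_eq0 (hermX x)); rewrite (herm_suml (hermX x)) -[RHS](hc (mulI A)).
  rewrite [X in _ = _ + X]big1 ?addr0 // => j _.
  by rewrite al_mulI // al_vertical // mulr0 !mulr0.
have cl a : c (lshift m a) = 0 by exact: (fr (fun a => c (lshift m a)) A0 a).
have [u du] := indep_det gx fr.
pose M := \matrix_(i, j) al j x (u i).
have uM : M \in unitmx by rewrite unitmxE unitfE.
have Re0 w : \sum_j (c (rshift k j) * nu j x) * complex.Re (al j x w) = 0.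
  have := hc w; rewrite big1 ?add0r => [hw|a _]; last by rewrite cl mul0r.
  by rewrite -[RHS]hw; apply: eq_bigr => j _; rewrite mulrA.
(* A complex linear form with zero real part is zero, as evaluation at [mulI w] shows. The real
   relation thus becomes a complex one, which the nonsingular matrix [M] forbids. *)
have S0 w : \sum_j rC (c (rshift k j) * nu j x) * al j x w = 0.
  set S := \sum_j _.
  have ReS : complex.Re S = 0 by rewrite Re_sum -[RHS](Re0 w); apply: eq_bigr => j _; rewrite ReZ.
  have ImS : complex.Re (Complex 0 1 * S) = 0.
    rewrite mulr_sumr Re_sum -[RHS](Re0 (mulI w)); apply: eq_bigr => j _.
    by rewrite al_mulI // mulrCA ReZ.
  move: ReS ImS; case: S => p q /= ->; rewrite mul0r mul1r sub0r => /eqP.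
  by rewrite oppr_eq0 => /eqP ->.
have c0 : (\col_j rC (c (rshift k j) * nu j x)) = 0.
  rewrite -[LHS](mulKmx uM) (_ : M *m _ = 0) ?mulmx0 //.
  apply/colP => i; rewrite !mxE -[RHS](S0 (u i)); apply: eq_bigr => j _.
  by rewrite !mxE mulrC.
move=> i; case: (split_ordP i) => [a|j] ->; first exact: cl.
have /colP/(_ j) := c0; rewrite !mxE => -[/eqP]; rewrite mulf_eq0 => /orP[/eqP//|].
have : 0 < nu j x by rewrite /nu cmodE sqrtr_gt0; apply: cmod_gt0; exact: fx.
by move=> /lt0r_neq0/negbTE ->.
Qed.

(** At a zero of [f j] the component [nu j] attains its minimum 0, so its differential vanishes and
    [rho] cannot be a submersion. *)
Lemma regular_good x : ~ D x -> regular_point rho x -> good x.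
Proof.
move=> nD [[U [oU Ux sU]] sx]; split => // j; apply/negP => /eqP fj0.
have dr : mdiff rho x by exact: smooth_mdiff sU Ux.
have dn : mdiff (nu j) x.
  rewrite -rho_coordr; apply: (differentiable_comp dr (g := fun v : 'rV[R]_(k + m) => v 0 (rshift k j))).
  exact: differentiable_coord.
have nu0 : nu j x = 0 by rewrite /nu fj0 /cmod /= expr0n /= addr0 sqrtr0.
have [u] := sx (delta_mx 0 (rshift k j)).
move=> /rowP/(_ (rshift k j)); rewrite -der_coord // rho_coordr mxE !eqxx /=.
rewrite nonneg_der0 // => [/esym/eqP|y]; first by rewrite oner_eq0.
by rewrite /nu cmodE sqrtr_ge0.
Qed.

Lemma regular_indep x : good x -> regular_point rho x -> indep x.
Proof.
move=> gx [_ sx] c c0 a.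
have [u eu] := sx (delta_mx 0 (lshift m a)).
have : wX x (\sum_b c b *: V b x) u = 0 by rewrite c0 (herm0l (hermX x)).
rewrite (herm_suml (hermX x)) (bigD1 a) //= big1 => [|b ba].
  by rewrite -rho_derl // eu mxE !eqxx mulr1 addr0.
by rewrite -rho_derl // eu mxE (inj_eq (@lshift_inj _ _)) (negbTE ba) mulr0.
Qed.

(* The lifting condition only concerns functions which are smooth on the whole of
   [Y]; the moment map of [Y] already supplies enough of them, since the fields of
   the compact torus span the tangent spaces of the open orbit over the complex
   numbers, so that no cut-off functions are needed. *)
Lemma horizontal_conformal x : good x -> indep x -> exists c : R, forall v W,
  (forall u, wX x W u = wY (F x) v (tmap F x u)) -> tmap F x W = c *: v.
Proof.
move=> gx fr; have [nD _] := gx; have oy := map_open_orbit nD.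
have [fl hl] := ps_lift P; exists (fl x).
have [muY hmuY] := ham_moment (tk_hamiltonian Y).
have saY := torus_smooth_action (ham_action (tk_hamiltonian Y)).
pose t (a : 'rV[R]_m) := velocity (act := fun t => @tk_act R m Y (0, t)) a (F x).
apply: (conformal_lift (t := t) (hermX x) (hermY (F x))).
- exact/tmap_linear/ps_map_mdiff.
- by move=> u; exact: tmap_mulI.
- exact: tmap_surj.
- by move=> v; exact: toric_span.
move=> a V0 W h1 h2 h3.
pose l (v : 'rV[R]_m) : R := \sum_i a 0 i * v 0 i.
have ll : linear (l : 'rV[R]_m -> R).
  move=> c u v; rewrite /l /GRing.scale /= mulr_sumr -big_split; apply: eq_bigr => i _.
  by rewrite !mxE /= mulrDr mulrCA.
have cl := findim_linear_continuous (@findim_rV R m) ll.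
have sm : smooth_on setT (l \o muY).
  move=> p r; apply: (Ck_linear _ cl ll (f := muY \o chartV p)); last exact: moment_smooth hmuY p r.
  by apply: open_img; exact: openT.
have dmu : mdiff muY (F x) by exact: smooth_mdiff (moment_smooth hmuY) _.
have dh v : der (l \o muY) (F x) v = wY (F x) (t a) v.
  rewrite (der_linear_comp v cl ll dmu) /l.
  have -> : t a = \sum_i a 0 i *: t (row i 1%:M).
    have [T eT] := linP (velocity_linear saY (F x)).
    have tT a' : t a' = T a' := esym (congr1 (@^~ a') eT).
    rewrite tT -[in LHS](mulmx1 a) mulmx_sum_row linear_sum.
    by apply: eq_bigr => i _; rewrite linearZ tT.
  rewrite (herm_suml (hermY _)); apply: eq_bigr => i _; congr (_ * _).
  rewrite -(der_coord v i dmu); exact: esym (moment_eq hmuY i (F x) v).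
have hV : hamiltonian_vec (@kform R (k + m) X) ((l \o muY) \o ps_map P) x V0.
  by move=> u; rewrite (der_comp (ps_map_mdiff nD) (smooth_mdiff sm I)) dh -h1.
have hv : hamiltonian_vec (@kform R m Y) (l \o muY) (ps_map P x) (t a).
  by move=> v; rewrite dh.
exact: (hl _ sm x (notin_base nD) (tmap_surj gx fr) V0 (t a) W hV hv (conj h2 h3)).
Qed.

Lemma hamiltonian_nu x : good x -> indep x -> exists H : 'I_m -> Cn R (k + m),
  (forall j u, wX x (H j) u = nu j x * complex.Re (al j x u)) /\
  (forall i j, wX x (H i) (H j) = 0).
Proof.
move=> gx fr; have [nD fx] := gx; have oy := map_open_orbit nD.
have [c hc] := horizontal_conformal gx fr.
have dc j : mdiff (fun y => cmod (f j y)) (F x).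
  apply: (smooth_mdiff (U := [set y : Y | open_orbit y /\ f j y != 0])) => //.
  exact: cmod_f_smooth.
have exv j : exists v, forall u, wY (F x) v u = der (fun y => cmod (f j y)) (F x) u.
  by apply: (herm_repr (hermY _)); exact: der_linear.
pose v j := sval (cid (exv j)).
have vE j u : wY (F x) (v j) u = der (fun y => cmod (f j y)) (F x) u by rewrite /v; case: cid.
have exH j : exists W, forall u, wX x W u = wY (F x) (v j) (tmap F x u).
  apply: (herm_repr (hermX _)) => a u1 u2.
  by rewrite (tmap_linear (ps_map_mdiff nD)) (hermDr (hermY _)) (hermZr (hermY _)).
pose H j := sval (cid (exH j)).
have HE j u : wX x (H j) u = wY (F x) (v j) (tmap F x u) by rewrite /H; case: cid.
exists H; split => [j u|i j].
  by rewrite HE vE -nu_der // -(der_comp (ps_map_mdiff nD) (dc j)).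
(* This reads [wX (H i) (H j) = wY (v i) (tmap F x (H j)) = c * wY (v i) (v j)]. *)
rewrite HE (hc _ _ (HE j)) (hermZr (hermY _)).
have e : wY (F x) (v i) (v j) = 0 := hpoisson oy (fx i) (fx j) (vE i) (vE j).
by rewrite e mulr0.
Qed.

Lemma regular_near x : ~ D x -> regular_point rho x ->
  \forall y \near x, ~ D y /\ regular_point rho y.
Proof.
move=> nD rx; have gx := regular_good nD rx.
have n1 := submersion_near open_good rho_smooth gx rx.2.
have n2 := open_nbhs_nbhs (conj open_good gx).
move: n1 n2; apply: filterS2 => y sy gy; split; first by case: gy.
by split => //; exists good; split => //; [exact: open_good|exact: rho_smooth].
Qed.

Lemma lagrangian_frame x : ~ D x -> regular_point rho x ->
  exists Z : 'I_(k + m) -> Cn R (k + m),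
    [/\ forall i j, wX x (Z i) (Z j) = 0,
        forall c : 'I_(k + m) -> R, \sum_i c i *: Z i = 0 -> forall i, c i = 0,
        forall u, der rho x u = 0 -> forall i, wX x (Z i) u = 0 &
        exists r : R, nform Omega x Z = Complex 0 1 ^+ m * rC r].
Proof.
move=> nD rx; have gx := regular_good nD rx; have fr := regular_indep gx rx.
have [H [HE HH]] := hamiltonian_nu gx fr.
pose Z (i : 'I_(k + m)) := match fintype.split i with
  | inl a => V (rev_ord a) x | inr j => H j end.
(* [Z i] is the Hamiltonian vector of the component [s i] of [rho]. As [s] is injective and [rho] is
   a submersion, vectors dual to the [Z i] exist, whence their independence. *)
pose s (i : 'I_(k + m)) := match fintype.split i with
  | inl a => lshift m (rev_ord a) | inr j => rshift k j end.
have Zl a : Z (lshift m a) = V (rev_ord a) x by rewrite /Z (unsplitK (inl _)).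
have Zr j : Z (rshift k j) = H j by rewrite /Z (unsplitK (inr _)).
have ZE i u : wX x (Z i) u = der rho x u 0 (s i).
  rewrite /Z /s; case: (fintype.split i) => [a|j]; first by rewrite rho_derl.
  by rewrite rho_derr.
have HV j a : wX x (H j) (V a x) = 0.
  by rewrite HE al_vertical ?mulr0 //; exact: V_vertical.
exists Z; split.
- move=> i j; rewrite /Z; case: (fintype.split i) => a; case: (fintype.split j) => b.
  + exact: V_isotropic.
  + by rewrite (herm_anti (hermX x)) HV oppr0.
  + exact: HV.
  + exact: HH.
- move=> c c0 i; have [u eu] := rx.2 (delta_mx 0 (s i)).
  have : wX x (\sum_i c i *: Z i) u = 0 by rewrite c0 (herm0l (hermX x)).
  rewrite (herm_suml (hermX x)) (bigD1 i) //= big1 => [|l li].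
    by rewrite ZE eu mxE !eqxx mulr1 addr0.
  rewrite ZE eu mxE eqxx /= (_ : s l == s i = false) ?mulr0 //.
  apply: contraNF li; rewrite /s.
  case: (split_ordP l) => [a|a] ->; case: (split_ordP i) => [b|b] ->.
  + by rewrite !(inj_eq (@lshift_inj _ _)) (inj_eq rev_ord_inj).
  + by rewrite eq_lrshift.
  + by rewrite eq_rlshift.
  + by [].
- by move=> u u0 i; rewrite ZE u0 mxE.
(* Isotropy of the [H j] reads [nu j x * Re (al j x (H i)) = 0] with [nu j x] positive, so all
   entries are purely imaginary. *)
have [r er] : exists r : R, \det (\matrix_(i, j) al j x (H i)) = Complex 0 1 ^+ m * rC r.
  apply: det_imaginary => i j; rewrite mxE.
  have := HE j (H i); rewrite HH => /esym/eqP; rewrite mulf_eq0 => /orP[|/eqP//].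
  have : 0 < nu j x by rewrite /nu cmodE sqrtr_gt0; apply: cmod_gt0; exact: gx.2.
  by move=> /lt0r_neq0/negbTE ->.
exists r; rewrite -er; exact: (hcontract nD gx.2 H).
Qed.

Lemma rho_special_lagrangian c :
  special_lagrangian Omega [set x | [/\ ~ D x, regular_point rho x & rho x = c]].
Proof.
set L := [set x | _].
pose U : set X := [set x | ~ D x /\ regular_point rho x].
have oU : open U by rewrite openE => x [nD rx]; exact: regular_near.
have gU x : U x -> good x by move=> [nD rx]; exact: regular_good.
have sg : smooth_on U (fun x => rho x - c).
  move=> p r; apply: Ck_add; [exact: open_img| |exact: Ck_cst].
  by apply: Ck_mono (rho_smooth p r) => _ [x [dx /gU gx] <-]; exists x.
have dg x u : U x -> der (fun x => rho x - c) x u = der rho x u.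
  move=> /gU gx; have := @deriveB _ _ _ (rho \o chartV x) (cst c) (chart x x) u.
  rewrite derive_cst subr0; apply; last exact: derivable_cst.
  by apply: diff_derivable; exact: rho_mdiff.
have loc : local_equation L U (fun x => rho x - c).
  split => // [x [nD rx]|x Ux w].
    split => [[_ _ ->]|/eqP]; first by rewrite subrr.
    by rewrite subr_eq0 => /eqP ec; split.
  by have [u eu] := Ux.2.2 w; exists u; rewrite dg.
have LU x : L x -> U x by case.
have tan x u : L x -> tangent L x u -> der rho x u = 0.
  by move=> /LU Ux /(_ U _ Ux loc); rewrite dg.
have span x : L x -> exists Z : 'I_(k + m) -> Cn R (k + m),
    [/\ forall i j, wX x (Z i) (Z j) = 0,
        forall u, tangent L x u -> exists a : 'I_(k + m) -> R, u = \sum_i a i *: Z i &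
        exists r : R, nform Omega x Z = Complex 0 1 ^+ m * rC r].
  move=> Lx; have [nD rx _] := Lx.
  have [Z [iso ind ker phs]] := lagrangian_frame nD rx.
  exists Z; split => // u /(tan _ _ Lx)/ker; exact: (lagrangian_span (hermX x)).
split; first split.
- by move=> x Lx; exists U, (fun x => rho x - c); split => //; exact: LU.
- move=> x u v Lx; have [Z [iso sp _]] := span x Lx => /sp[a ->] /sp[b ->].
  rewrite -/(wX x _ _) (herm_suml (hermX x)) big1 // => i _.
  by rewrite (herm_sumr (hermX x)) big1 ?mulr0 // => j _; rewrite iso mulr0.
(* The angle depends on [m] alone, so it is common to all points of the fibre. *)
have [theta ht] := phase m (R := R).
exists theta => x v Lx tv; have [Z [_ sp [r er]]] := span x Lx.
have ex i : exists a : 'I_(k + m) -> R, v i = \sum_j a j *: Z j by apply: sp.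
pose A := \matrix_(i, j) sval (cid (ex i)) j.
have vE i : v i = \sum_j A i j *: Z j.
  by rewrite {1}(svalP (cid (ex i))); apply: eq_bigr => j _; rewrite mxE.
(* A change of tangent frame is a real matrix, so it multiplies the value of the form by a real
   determinant and leaves the phase unchanged. *)
have -> : nform Omega x v = rC (\det A) * nform Omega x Z.
  rewrite /nform mulrCA; congr (_ * _).
  rewrite -det_map_mx -det_mulmx; congr (\det _); apply/matrixP => i j.
  rewrite [LHS]mxE vE toC_sum summxE [RHS]mxE; apply: eq_bigr => l _.
  by rewrite toCZ !mxE.
by rewrite er mulrCA ImZ ht mulr0.
Qed.

Lemma regular_dense (O : set X) : open O -> O `&` ~` D !=set0 ->
  exists2 x, (O `&` ~` D) x & regular_point rho x.
Proof.
move=> oO ne.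
(* [hf_nonzero] treats a single index; shrinking the open set once for each [j] makes all the [f j]
   nonzero simultaneously. *)
have [A1 [oA1 neA1 sub1 f1]] : exists A1 : set X,
    [/\ open A1, A1 !=set0, A1 `<=` O `&` ~` D &
        forall j, j \in enum 'I_m -> forall x, A1 x -> f j (F x) != 0].
  elim: (enum 'I_m) => [|j s [A1 [oA1 [x0 A1x0] sub1 f1]]].
    by exists (O `&` ~` D); split => //; apply: openI => //; exact: open_divisor_compl.
  have [|x [A1x nDx] fx] := hf_nonzero j oA1.
    by exists x0; split => //; exact: (sub1 _ A1x0).2.
  exists (A1 `&` ((~` ps_base P) `&` F @^-1` [set y : Y | open_orbit y /\ f j y != 0])).
  split.
  - apply: openI => //; exact: (holo_preimage_open open_base_compl ps_map_holo (@open_f_nonzero j)).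
  - by exists x; split => //; split; [exact: notin_base|split => //; exact: map_open_orbit].
  - by move=> y [/sub1].
  - move=> l; rewrite inE => /orP[/eqP -> y [_ [_ []]]//|ls y [A1y _]].
    exact: f1.
have gA1 x : A1 x -> good x.
  by move=> A1x; split; [exact: (sub1 _ A1x).2|move=> j; apply: f1 => //; rewrite mem_enum].
apply: contrapT => nreg.
have dep x : A1 x -> exists2 c, c != 0 & velocity (act := ps_act P) c x = 0.
  move=> A1x; apply: contrapT => nc; apply: nreg; exists x; first exact: sub1.
  apply: good_regular; first exact: gA1.
  move=> c c0; have [T eT] := linP (velocity_linear ps_act_smooth x).
  have eV : T ((\row_a c a) *m xi) = \sum_a c a *: V a x.
    rewrite mulmx_sum_row linear_sum; apply: eq_bigr => a _.
    by rewrite linearZ /= eT mxE.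
  have cxi : (\row_a c a) *m xi = 0.
    apply: contrapT => /eqP cn0; apply: nc; exists ((\row_a c a) *m xi) => //.
    by rewrite -(congr1 (@^~ (\row_a c a *m xi)) eT) eV.
  have : \row_a c a = 0 by rewrite -[LHS](mulmxK hxi.1) cxi mul0mx.
  by move=> /rowP h a; have := h a; rewrite !mxE.
have per := torus_period (ham_action (ps_hamiltonian P)).
have [p p0 vp] := dependent_torus_action ps_act_smooth per oA1 neA1 dep.
(* The coordinates of [p] in the basis [xi] are constants that give a relation between the fields at
   every point of [X], so [generating_basis] makes them vanish. *)
pose c : 'rV[R]_k := map_mx intr p *m invmx xi.
have c0 : forall a, c 0 a = 0.
  apply: hxi.2 => x; have [T eT] := linP (velocity_linear ps_act_smooth x).
  have := vp x; rewrite -(congr1 (@^~ (map_mx intr p)) eT) -(mulmxKV hxi.1 (map_mx intr p)).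
  rewrite -/c mulmx_sum_row linear_sum => h0; rewrite -[RHS]h0; apply: eq_bigr => a _.
  by rewrite linearZ /= eT.
have : map_mx intr p = 0 :> 'rV[R]_k.
  rewrite -(mulmxKV hxi.1 (map_mx intr p)) -/c (_ : c = 0) ?mul0mx //.
  by apply/rowP => a; rewrite c0 mxE.
move=> /rowP h; move/eqP: p0; apply; apply/rowP => a.
by have := h a; rewrite !mxE => /eqP; rewrite intr_eq0 => /eqP.
Qed.

End SpecialLagrangianFibration.


Theorem proposition3p1 (R : realType) (k m : nat)
    (X : kahlerManifold R (k + m)) (Y : toricKahlerManifold R m)
    (P : pseudotoric X Y)
    (xi : 'M[R]_k) (mu : X -> 'rV[R]_k)
    (hxi : generating_basis (ps_act P) xi)
    (hmu : moment_map (@kform R (k + m) X) (ps_act P) xi mu)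
    (D : set X) (Omega : X -> R[i])
    (hOmega : volume_form_simple_poles D Omega)
    (hD : forall s x, D (ps_act P s x) <-> D x)
    (hF : forall x, ~ D x -> ~ ps_base P x /\ ~ toric_divisor (ps_map P x))
    (f : 'I_m -> Y -> R[i])
    (hf_mero : forall j, meromorphic_function (f j))
    (hf_holo : forall j, holo_on (@open_orbit R m Y) (f j))
    (hf_inv : forall j s x, ~ ps_base P x ->
       f j (ps_map P (ps_act P s x)) = f j (ps_map P x))
    (hf_nonzero : forall j (O : set X), open O -> O `&` ~` D !=set0 ->
       exists2 x, (O `&` ~` D) x & f j (ps_map P x) != 0)
    (hcontract : forall x, ~ D x -> (forall j, f j (ps_map P x) != 0) ->
       forall w : 'I_m -> Cn R (k + m),
         nform Omega x (fun i : 'I_(k + m) =>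
           match fintype.split i with
           | inl a => fundamental_field (ps_act P) (row (rev_ord a) xi) x
           | inr b => w b
           end)
         = \det (\matrix_(i, j) dlog (f j \o ps_map P) x (w i)))
    (hpoisson : forall i j y, @open_orbit R m Y y ->
       f i y != 0 -> f j y != 0 ->
       poisson_commute_at (fun y => cmod (f i y)) (fun y => cmod (f j y)) y) :
  special_lagrangian_fibration Omega (~` D)
    (fun x => row_mx (mu x) (\row_j cmod (f j (ps_map P x)))).
Proof.
split; first exact: (regular_dense hxi hmu hOmega hF hf_holo hf_nonzero hcontract).
exact: (rho_special_lagrangian hmu hOmega hF hf_holo hcontract hpoisson).
Qed.
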